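(* Consider the basic noncommutative cubes and the associated spheres, with the inclusions $$\widehat{\mathbb Z_2^N}\subset\widehat{\mathbb Z_2^{\circ N}}\subset\widehat{\mathbb Z_2^{*N}},\qquad S^{N-1}_{\mathbb R}\subset S^{N-1}_{\mathbb R,*}\subset S^{N-1}_{\mathbb R,\infty},$$ $$\widehat{\mathbb Z_2^N}\subset S^{N-1}_{\mathbb R},\quad \widehat{\mathbb Z_2^{\circ N}}\subset S^{N-1}_{\mathbb R,*},\quad \widehat{\mathbb Z_2^{*N}}\subset S^{N-1}_{\mathbb R,\infty}.$$ The corresponding quantum reflection groups are $$H^+(S^{N-1}_{\mathbb R})=H^+(\widehat{\mathbb Z_2^N})=H_N,$$ $$H^+(S^{N-1}_{\mathbb R,*})=H^+(\widehat{\mathbb Z_2^{\circ N}})=H_N^*,$$ $$H^+(S^{N-1}_{\mathbb R,\infty})=H^+(\widehat{\mathbb Z_2^{*N}})=H_N^{[\infty]},$$ with inclusions $H_N\subset H_N^*\subset H_N^{[\infty]}$.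
   Context: $O_N^+$ is the free orthogonal quantum group: $C(O_N^+)$ is the universal $C^*$-algebra generated by the entries of an $N\times N$ matrix $u=(u_{ij})$ with $u=\bar u$, $u^t=u^{-1}$, with $\Delta(u_{ij})=\sum_ku_{ik}\otimes u_{kj}$. Closed quantum subgroups $G\subset O_N^+$ correspond to quotients $C(G)$ of $C(O_N^+)$ to which the quantum group structure factors. $H_N\subset O_N$ is the hyperoctahedral group (signed permutation matrices). $H_N^{[\infty]}\subset O_N^+$ is defined by the relations $abc=0$ for $a,b,c\in\{u_{ij}\}$ with $a\neq c$ on the same row or column of $u$. $H_N^+\subset O_N^+$ is defined by $ab=0$ for $a\neq b\in\{u_{ij}\}$ on the same row or column of $u$, and $H_N^*\subset H_N^+$ by the additional relations $abc=cba$ for all $a,b,c\in\{u_{ij}\}$. The free real sphere is $C(S^{N-1}_{\mathbb R,+})=C^*(x_1,\ldots,x_N\mid x_i=x_i^*,\ \sum_ix_i^2=1)$; closed subsets correspond to quotient $C^*$-algebras. $S^{N-1}_{\mathbb R}$ is the usual sphere, $S^{N-1}_{\mathbb R,*}$ is obtained via $x_ix_jx_k=x_kx_jx_i$, and $S^{N-1}_{\mathbb R,\infty}$ via $x_i^2x_j=x_jx_i^2$, for all $i,j,k$. For a group $\Gamma=\langle g_1,\ldots,g_N\rangle$ with $g_i^2=1$, the dual $\widehat\Gamma$, given by $C(\widehat\Gamma)=C^*(\Gamma)$, is embedded in $S^{N-1}_{\mathbb R,+}$ via $x_i=g_i/\sqrt N$. $\mathbb Z_2^{\circ N}$ is the quotient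 of the free product $\mathbb Z_2^{*N}$ by the relations $abc=cba$ between the generators. $G\subset O_N^+$ acts affinely on $X\subset S^{N-1}_{\mathbb R,+}$, written $G\curvearrowright X$, if $\Phi(x_i)=\sum_ju_{ij}\otimes x_j$ defines a coaction map $C(X)\to C(G)\otimes C(X)$. The quantum reflection group of $X$ is $H^+(X)=\max\{G\subset H_N^{[\infty]}\mid G\curvearrowright X\}$. *)

(* Defs.v *)
From HB Require Import structures.
From mathcomp Require Import all_boot all_order all_algebra all_fingroup.
From mathcomp Require Import all_classical all_reals all_analysis.
From mathcomp Require Import complex ring lra.

Set Implicit Arguments.
Unset Strict Implicit.
Unset Printing Implicit Defensive.

Import Order.TTheory GRing.Theory Num.Theory.
Import numFieldNormedType.Exports.

Local Open Scope classical_set_scope.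
Local Open Scope ring_scope.
Local Open Scope complex_scope.

(* Unital complex C*-algebras.  The norm is a field of the structure, because
   Hierarchy Builder cannot join normedModType with algType; algType carries
   1 != 0, so the zero algebra is excluded. *)

HB.mixin Record Algebra_isCStar (R : realType) A of GRing.Algebra R[i] A := {
  star : A -> A;
  starD : forall a b, star (a + b) = star a + star b;
  starZ : forall (c : R[i]) a, star (c *: a) = c^* *: star a;
  starM : forall a b, star (a * b) = star b * star a;
  starK : involutive star;
  cnorm : A -> R;
  cnormD : forall a b, cnorm (a + b) <= cnorm a + cnorm b;
  cnormZ : forall (c : R[i]) a, cnorm (c *: a) = Normc.normc c * cnorm a;
  cnorm_eq0 : forall a, cnorm a = 0 -> a = 0;
  cnormM : forall a b, cnorm (a * b) <= cnorm a * cnorm b;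
  cstar_identity : forall a, cnorm (star a * a) = cnorm a ^+ 2;
  cnorm_complete : forall u : nat -> A,
    (forall e, 0 < e -> \forall m & n \near \oo, cnorm (u m - u n) < e) ->
    exists l, cnorm (u n - l) @[n --> \oo] --> (0 : R)
}.

#[short(type="cstarType")]
HB.structure Definition CStar (R : realType) :=
  {A of GRing.Algebra R[i] A & Algebra_isCStar R A}.

Section NormC.
Variable R : realType.
Implicit Types z : R[i].

Lemma normc_ge0 z : 0 <= Normc.normc z.
Proof. by case: z => a b; rewrite /= sqrtr_ge0. Qed.

Lemma normcJ z : Normc.normc z^* = Normc.normc z.
Proof. by case: z => a b; rewrite /= sqrrN. Qed.

Lemma normc_Re z : `|complex.Re z| <= Normc.normc z.
Proof.
case: z => a b /=; rewrite -sqrtr_sqr ler_wsqrtr // lerDl sqr_ge0 //.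
Qed.

Lemma normc_Im z : `|complex.Im z| <= Normc.normc z.
Proof.
case: z => a b /=; rewrite -sqrtr_sqr ler_wsqrtr // lerDr sqr_ge0 //.
Qed.

Lemma normc_le z : Normc.normc z <= `|complex.Re z| + `|complex.Im z|.
Proof.
case: z => a b /=; rewrite -(ler_pXn2r (ltn0Sn 1)) ?nnegrE ?sqrtr_ge0 ?addr_ge0 //.
rewrite sqr_sqrtr ?addr_ge0 ?sqr_ge0 // sqrrD !real_normK ?num_real //.
by rewrite lerD2r lerDl mulrn_wge0 // mulr_ge0.
Qed.

Lemma complex_normE z : `|z| = (Normc.normc z)%:C.
Proof. by case: z. Qed.

Lemma conjc_continuous : continuous (fun z : R[i]^o => z^* : R[i]^o).
Proof.
move=> z; apply/(@cvgrPdist_lt R[i] R[i]^o R[i]^o (nbhs z) (nbhs_filter z)).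
move=> e e0.
have /(@cvgrPdist_lt R[i] R[i]^o R[i]^o (nbhs z) (nbhs_filter z))/(_ e e0) :=
  @cvg_id _ (nbhs z).
by apply: filterS => y; rewrite -raddfB /= !complex_normE normcJ.
Qed.

Lemma normc_continuous : continuous (fun z : R[i]^o => Normc.normc z : R).
Proof.
move=> z; apply/(@cvgrPdist_lt R R R[i]^o (nbhs z) (nbhs_filter z)) => e e0.
have eC : 0 < e%:C by rewrite ltcR.
have /(@cvgrPdist_lt R[i] R[i]^o R[i]^o (nbhs z) (nbhs_filter z))/(_ _ eC) :=
  @cvg_id _ (nbhs z).
apply: filterS => y; rewrite /= complex_normE ltcR; apply: le_lt_trans.
have := ler_dist_dist z y; rewrite !complex_normE -rmorphB /= lecR.
by rewrite /= expr0n addr0 sqrtr_sqr.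
Qed.

End NormC.

Record compact_set (T : topologicalType) := CompactSet {
  cset :> set T;
  cset_compact : compact cset;
  cset_neq0 : cset !=set0
}.

Record cfun (R : realType) (T : topologicalType) (K : compact_set T) := CFun {
  cfun_fun :> set_type K -> R[i];
  cfun_cont : continuous (cfun_fun : set_type K -> R[i]^o)
}.

Section CFun.
Variables (R : realType) (T : topologicalType) (K : compact_set T).
Local Notation cfunK := (cfun R K).
Local Notation nrm := (@Normc.normc R).
Implicit Types f g h : cfunK.

HB.instance Definition _ := gen_eqMixin cfunK.
HB.instance Definition _ := gen_choiceMixin cfunK.

Lemma cfunP f g : (forall x, f x = g x) -> f = g.
Proof.
case: f => f fc; case: g => g gc /= /funext fg; subst g.
by rewrite (Prop_irrelevance fc gc).
Qed.

Lemma cfun_cst_subproof (c : R[i]) :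
  continuous (fun _ : set_type K => c : R[i]^o).
Proof. by move=> x; apply: cvg_cst; exact: nbhs_filter. Qed.
Definition cfun_cst c : cfunK := CFun (@cfun_cst_subproof c).

Lemma cfun_add_subproof f g : continuous (fun x => f x + g x : R[i]^o).
Proof. by move=> x; exact: (cvgD (@cfun_cont _ _ _ f x) (@cfun_cont _ _ _ g x)). Qed.
Definition cfun_add f g : cfunK := CFun (@cfun_add_subproof f g).

Lemma cfun_mul_subproof f g : continuous (fun x => f x * g x : R[i]^o).
Proof. by move=> x; exact: (cvgM (@cfun_cont _ _ _ f x) (@cfun_cont _ _ _ g x)). Qed.
Definition cfun_mul f g : cfunK := CFun (@cfun_mul_subproof f g).

Definition cfun_opp f : cfunK := cfun_mul (cfun_cst (-1)) f.
Definition cfun_scale c f : cfunK := cfun_mul (cfun_cst c) f.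

Lemma cfun_star_subproof f : continuous (fun x => (f x)^* : R[i]^o).
Proof.
move=> x; exact: (@continuous_comp (set_type K) R[i]^o R[i]^o f _ x
  (@cfun_cont _ _ _ f x) (@conjc_continuous R (f x))).
Qed.
Definition cfun_star f : cfunK := CFun (@cfun_star_subproof f).

Fact cfun_addA : associative cfun_add.
Proof. by move=> f g h; apply: cfunP => x /=; rewrite addrA. Qed.
Fact cfun_addC : commutative cfun_add.
Proof. by move=> f g; apply: cfunP => x /=; rewrite addrC. Qed.
Fact cfun_add0 : left_id (cfun_cst 0) cfun_add.
Proof. by move=> f; apply: cfunP => x /=; rewrite add0r. Qed.
Fact cfun_addN : left_inverse (cfun_cst 0) cfun_opp cfun_add.
Proof. by move=> f; apply: cfunP => x /=; rewrite mulN1r addNr. Qed.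

HB.instance Definition _ :=
  GRing.isZmodule.Build cfunK cfun_addA cfun_addC cfun_add0 cfun_addN.

Fact cfun_mulA : associative cfun_mul.
Proof. by move=> f g h; apply: cfunP => x /=; rewrite mulrA. Qed.
Fact cfun_mul1l : left_id (cfun_cst 1) cfun_mul.
Proof. by move=> f; apply: cfunP => x /=; rewrite mul1r. Qed.
Fact cfun_mul1r : right_id (cfun_cst 1) cfun_mul.
Proof. by move=> f; apply: cfunP => x /=; rewrite mulr1. Qed.
Fact cfun_mulDl : left_distributive cfun_mul +%R.
Proof. by move=> f g h; apply: cfunP => x /=; rewrite mulrDl. Qed.
Fact cfun_mulDr : right_distributive cfun_mul +%R.
Proof. by move=> f g h; apply: cfunP => x /=; rewrite mulrDr. Qed.

Lemma cfun_point : exists x : set_type K, True.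
Proof.
by have [x Kx] := cset_neq0 K; exists (exist _ x (mem_set Kx)).
Qed.

Fact cfun_1neq0 : cfun_cst 1 != 0 :> cfunK.
Proof.
apply/eqP => e; have [x _] := cfun_point.
by have /eqP := congr1 (fun f : cfunK => f x) e; rewrite /= oner_eq0.
Qed.

HB.instance Definition _ := GRing.Zmodule_isNzRing.Build cfunK
  cfun_mulA cfun_mul1l cfun_mul1r cfun_mulDl cfun_mulDr cfun_1neq0.

Fact cfun_scaleA a b f : cfun_scale a (cfun_scale b f) = cfun_scale (a * b) f.
Proof. by apply: cfunP => x /=; rewrite mulrA. Qed.
Fact cfun_scale1 : left_id 1 cfun_scale.
Proof. by move=> f; apply: cfunP => x /=; rewrite mul1r. Qed.
Fact cfun_scaleDr : right_distributive cfun_scale +%R.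
Proof. by move=> c f g; apply: cfunP => x /=; rewrite mulrDr. Qed.
Fact cfun_scaleDl f : {morph cfun_scale^~ f : a b / a + b}.
Proof. by move=> a b; apply: cfunP => x /=; rewrite mulrDl. Qed.

HB.instance Definition _ := GRing.Zmodule_isLmodule.Build R[i] cfunK
  cfun_scaleA cfun_scale1 cfun_scaleDr cfun_scaleDl.

Fact cfun_scaleAl (a : R[i]) f g : a *: (f * g) = (a *: f) * g.
Proof. by apply: cfunP => x /=; rewrite mulrA. Qed.
Fact cfun_scaleAr (a : R[i]) f g : a *: (f * g) = f * (a *: g).
Proof. by apply: cfunP => x /=; rewrite mulrCA. Qed.

HB.instance Definition _ :=
  GRing.Lmodule_isLalgebra.Build R[i] cfunK cfun_scaleAl.
HB.instance Definition _ :=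
  GRing.Lalgebra_isAlgebra.Build R[i] cfunK cfun_scaleAr.

Lemma cfun_addE f g x : (f + g) x = f x + g x. Proof. by []. Qed.
Lemma cfun_oppE f x : (- f) x = - f x. Proof. exact: mulN1r. Qed.
Lemma cfun_mulE f g x : (f * g) x = f x * g x. Proof. by []. Qed.
Lemma cfun_scaleE (c : R[i]) f x : (c *: f) x = c * f x. Proof. by []. Qed.
Lemma cfun_starE f x : cfun_star f x = (f x)^*. Proof. by []. Qed.

Fact cfun_starD f g : cfun_star (f + g) = cfun_star f + cfun_star g.
Proof. by apply: cfunP => x /=; rewrite -raddfD. Qed.
Fact cfun_starZ (c : R[i]) f : cfun_star (c *: f) = c^* *: cfun_star f.
Proof. by apply: cfunP => x /=; rewrite -rmorphM. Qed.
Fact cfun_starM f g : cfun_star (f * g) = cfun_star g * cfun_star f.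
Proof. by apply: cfunP => x /=; rewrite -rmorphM mulrC. Qed.
Fact cfun_starK : involutive cfun_star.
Proof. by move=> f; apply: cfunP => x /=; rewrite conjcK. Qed.

Definition cfun_norm f : R := sup (range (fun x => nrm (f x))).

Lemma cfun_bounded f : exists M, forall x, nrm (f x) <= M.
Proof.
have nf : continuous (fun x => nrm (f x) : R).
  move=> x; exact: (@continuous_comp (set_type K) R[i]^o R f _ x
    (@cfun_cont _ _ _ f x) (@normc_continuous R (f x))).
have nfL : {within K, continuous (valL_ 0 (fun x => nrm (f x)))}.
  exact/(@subspace_valL_continuousP' T K R 0).
have [c _ fc] := compact_EVT_max (cset_neq0 K) (@cset_compact _ K) nfL.
exists (valL_ 0 (fun x => nrm (f x)) c) => x.
have := fc (val x) (valP x); rewrite -set_valE.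
have /(congr1 (@^~ x)) := valLK 0 (fun x => nrm (f x)).
by rewrite /sigL /= => ->.
Qed.

Lemma cfun_le_norm f x : nrm (f x) <= cfun_norm f.
Proof.
have [M Mf] := cfun_bounded f; apply: sup_upper_bound; last by exists x.
by split; [exists (nrm (f x)), x | exists M => _ [y _ <-]].
Qed.

Lemma cfun_norm_le f (M : R) : (forall x, nrm (f x) <= M) -> cfun_norm f <= M.
Proof.
move=> fM; apply: sup_le_ub; last by move=> _ [x _ <-].
by have [x _] := cfun_point; exists (nrm (f x)), x.
Qed.

Fact cfun_normD f g : cfun_norm (f + g) <= cfun_norm f + cfun_norm g.
Proof.
apply: cfun_norm_le => x; apply: (le_trans (le_normcD _ _)).
by apply: lerD; exact: cfun_le_norm.
Qed.

Fact cfun_normM f g : cfun_norm (f * g) <= cfun_norm f * cfun_norm g.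
Proof.
apply: cfun_norm_le => x; rewrite cfun_mulE Normc.normcM.
by apply: ler_pM; rewrite ?normc_ge0 ?cfun_le_norm.
Qed.

Lemma cfun_norm_ge0 f : 0 <= cfun_norm f.
Proof.
by have [x _] := cfun_point; apply: le_trans (cfun_le_norm f x); exact: normc_ge0.
Qed.

Fact cfun_normZ (c : R[i]) f : cfun_norm (c *: f) = nrm c * cfun_norm f.
Proof.
apply/le_anti/andP; split.
  apply: cfun_norm_le => x; rewrite cfun_scaleE Normc.normcM.
  by rewrite ler_wpM2l ?normc_ge0 ?cfun_le_norm.
have [->|c0] := eqVneq c 0; first by rewrite Normc.normc0 mul0r cfun_norm_ge0.
have nc0 : 0 < nrm c.
  rewrite lt_neqAle normc_ge0 andbT eq_sym; apply: contra c0 => /eqP.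
  by move/Normc.eq0_normc ->.
rewrite mulrC -ler_pdivlMr //; apply: cfun_norm_le => x.
by rewrite ler_pdivlMr // mulrC -Normc.normcM -cfun_scaleE cfun_le_norm.
Qed.

Fact cfun_norm_eq0 f : cfun_norm f = 0 -> f = 0.
Proof.
move=> f0; apply: cfunP => x; apply: Normc.eq0_normc.
by apply/le_anti; rewrite normc_ge0 andbT -f0 cfun_le_norm.
Qed.

Fact cfun_cstar_identity f :
  cfun_norm (cfun_star f * f) = cfun_norm f ^+ 2.
Proof.
apply/le_anti/andP; split.
  apply: cfun_norm_le => x; rewrite cfun_mulE Normc.normcM cfun_starE normcJ -expr2.
  by rewrite ler_pXn2r ?nnegrE ?normc_ge0 ?cfun_norm_ge0 ?cfun_le_norm.
rewrite -[leRHS]sqr_sqrtr ?cfun_norm_ge0 //.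
rewrite ler_pXn2r ?nnegrE ?sqrtr_ge0 ?cfun_norm_ge0 //.
apply: cfun_norm_le => x.
rewrite -[leLHS]ger0_norm ?normc_ge0 // -sqrtr_sqr ler_wsqrtr //.
apply: le_trans (cfun_le_norm _ x).
by rewrite cfun_mulE Normc.normcM cfun_starE normcJ -expr2.
Qed.

Lemma cfun_component_cvg (p : R[i] -> R) (u : nat -> cfunK) :
  (forall y z, p (y - z) = p y - p z) -> (forall z, `|p z| <= nrm z) ->
  (forall e, 0 < e -> \forall m & n \near \oo, cfun_norm (u m - u n) < e) ->
  exists l : set_type K -> R, forall e, 0 < e -> exists N, forall n, (N <= n)%N ->
    forall x, `|p (u n x) - l x| <= e.
Proof.
move=> pB pn uC.
have uC' e : 0 < e -> exists N, forall m n x, (N <= m)%N -> (N <= n)%N ->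
    `|p (u m x) - p (u n x)| < e.
  move=> /uC [[A B] /= [[N1 _ N1A] [N2 _ N2B]] AB].
  exists (maxn N1 N2) => m n x; rewrite !geq_max => /andP[m1 m2] /andP[n1 n2].
  rewrite -pB; apply: le_lt_trans (pn _) _.
  apply: le_lt_trans (AB (m, n) _); last by split; [exact: N1A|exact: N2B].
  by have := cfun_le_norm (u m - u n) x; rewrite cfun_addE cfun_oppE.
have cv x : cvg (p (u n x) @[n --> \oo]).
  apply: R_complete; apply: cauchy_exP => e e0.
  have [N uN] := uC' e e0; exists (p (u N x)); exists N => // n /= Nn.
  by rewrite /ball /=; exact: uN.
exists (fun x => lim (p (u n x) @[n --> \oo])) => e e0.
have [N uN] := uC' e e0; exists N => n Nn x.
have /(cvgB (cvg_cst (p (u n x)))) /cvg_norm cvn := cv x.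
rewrite /= in cvn; rewrite -(cvg_lim _ cvn) //; apply: limr_le.
  by apply/cvg_ex; eexists; exact: cvn.
by exists N => // m /= Nm; apply/ltW; exact: uN.
Qed.

Fact cfun_complete (u : nat -> cfunK) :
  (forall e, 0 < e -> \forall m & n \near \oo, cfun_norm (u m - u n) < e) ->
  exists l, cfun_norm (u n - l) @[n --> \oo] --> (0 : R).
Proof.
move=> uC.
have [l1 l1P] := cfun_component_cvg (@raddfB _ _ (@complex.Re R)) (@normc_Re R) uC.
have [l2 l2P] := cfun_component_cvg (@raddfB _ _ (@complex.Im R)) (@normc_Im R) uC.
pose l x := (l1 x +i* l2 x)%C.
have lP e : 0 < e -> exists N, forall n, (N <= n)%N -> forall x,
    nrm (u n x - l x) <= e.
  move=> e0; have e20 : 0 < e / 2 by rewrite divr_gt0.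
  have [N1 N1P] := l1P _ e20; have [N2 N2P] := l2P _ e20.
  exists (maxn N1 N2) => n; rewrite geq_max => /andP[n1 n2] x.
  apply: le_trans (normc_le _) _; rewrite [leRHS](splitr e).
  by have := N1P n n1 x; have := N2P n n2 x; case: (u n x) => a b /=; lra.
have lc : continuous (l : set_type K -> R[i]^o).
  move=> x.
  apply/(@cvgrPdist_lt R[i] R[i]^o (set_type K) (nbhs x) (nbhs_filter x)).
  move=> [e i]; rewrite ltcE /= => /andP[/eqP -> {i} e0].
  have e30 : 0 < e / 3 by rewrite divr_gt0.
  have [N NP] := lP _ e30; have e3C : 0 < (e / 3)%:C by rewrite ltcR.
  have := @cfun_cont _ _ _ (u N) x.
  move=> /(@cvgrPdist_lt R[i] R[i]^o (set_type K) (nbhs x) (nbhs_filter x)).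
  move=> /(_ _ e3C); apply: filterS => y; rewrite !complex_normE !ltcR => uxy.
  have -> : l x - l y = - (u N x - l x) + ((u N x - u N y) + (u N y - l y)).
    by ring.
  apply: (le_lt_trans (le_normcD _ _)); rewrite normcN.
  have := le_normcD (u N x - u N y) (u N y - l y).
  by have := NP N (leqnn N) x; have := NP N (leqnn N) y; move: uxy; lra.
exists (CFun lc); apply/cvgrPdist_le => e e0; have [N NP] := lP _ e0.
exists N => // n /= Nn; rewrite sub0r normrN ger0_norm ?cfun_norm_ge0 //.
by apply: cfun_norm_le => x; rewrite cfun_addE cfun_oppE; exact: NP.
Qed.

HB.instance Definition _ := Algebra_isCStar.Build R cfunK cfun_starD cfun_starZ
  cfun_starM cfun_starK cfun_normD cfun_normZ cfun_norm_eq0 cfun_normM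
  cfun_cstar_identity cfun_complete.

End CFun.

Section RealCoordinates.
Variables (R : realType) (m n : nat) (K : compact_set 'M[R]_(m, n)).

Lemma real_complex_continuous : continuous (fun x : R => x%:C : R[i]^o).
Proof.
move=> x; apply/(@cvgrPdist_lt R[i] R[i]^o R (nbhs x) (nbhs_filter x)).
move=> [e i]; rewrite ltcE /= => /andP[/eqP -> {i} e0].
have /(@cvgrPdist_lt R R R (nbhs x) (nbhs_filter x))/(_ e e0) :=
  @cvg_id _ (nbhs x).
apply: filterS => y; rewrite -rmorphB complex_normE ltcR /=.
by rewrite expr0n addr0 sqrtr_sqr.
Qed.

Lemma cfun_entry_subproof (p : 'I_m * 'I_n) :
  continuous (fun M : set_type K => (val M p.1 p.2)%:C : R[i]^o).
Proof.
move=> M; apply: (@continuous_comp (set_type K) R R[i]^o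
  (fun M : set_type K => val M p.1 p.2) _ M); last first.
  exact: real_complex_continuous.
apply: (@continuous_comp (set_type K) 'M[R]_(m, n) R
  (fun M : set_type K => val M) (fun A => A p.1 p.2) M).
  by have := @initial_continuous (set_type K) _ set_val; rewrite set_valE; apply.
exact: coord_continuous.
Qed.
Definition cfun_entry p : cfun R K := CFun (@cfun_entry_subproof p).

End RealCoordinates.

Definition sphere (R : realType) (N : nat) : set 'rV[R]_N :=
  [set x | \sum_i x 0 i ^+ 2 = 1].

Arguments sphere : clear implicits.

Lemma sphere_compact (R : realType) (N : nat) : compact (sphere R N).
Proof.
have box : compact [set x : 'rV[R]_N | forall i, `[(-1 : R), 1]%classic (x 0 i)].
  by apply: (@rV_compact R N (fun=> `[-1, 1]%classic)) => _; exact: segment_compact.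
apply: (subclosed_compact _ box) => [|x x1 i].
  have -> : sphere R N = (fun x : 'rV[R]_N => \sum_i x 0 i ^+ 2) @^-1` [set 1].
    by [].
  apply: closed_comp; last exact: closed_eq.
  move=> x _; elim: (index_enum 'I_N) => [|i r IH].
    have -> : (fun y : 'rV[R]_N => \sum_(i <- [::]) y 0 i ^+ 2) = fun=> 0.
      by apply/funext => y; rewrite big_nil.
    exact: (@cst_continuous 'rV[R]_N R 0).
  have -> : (fun y : 'rV[R]_N => \sum_(j <- i :: r) y 0 j ^+ 2) =
      fun y => y 0 i ^+ 2 + \sum_(j <- r) y 0 j ^+ 2.
    by apply/funext => y; rewrite big_cons.
  have xi := @coord_continuous R 1 N 0 i x.
  exact: (cvgD (cvgM xi xi) IH).
have : x 0 i ^+ 2 <= 1.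
  rewrite -[leRHS]x1 (bigD1 i) //= lerDl sumr_ge0 // => j _; exact: sqr_ge0.
by rewrite /= in_itv /= -ler_norml -real_normK ?num_real // expr_le1.
Qed.

Lemma sphere_neq0 (R : realType) (N : nat) : (0 < N)%N -> sphere R N !=set0.
Proof.
case: N => // n _; exists (delta_mx 0 0); rewrite /sphere /= big_ord_recl.
rewrite mxE !eqxx expr1n big1 ?addr0 // => i _.
by rewrite mxE eqxx /= expr0n.
Qed.

Definition signed_perm_mx (R : realType) (N : nat)
    (s : {perm 'I_N}) (e : {ffun 'I_N -> bool}) : 'M[R]_N :=
  \matrix_(i, j) if j == s i then (-1) ^+ e i else 0.

Definition hyperoctahedral (R : realType) (N : nat) : set 'M[R]_N :=
  [set M | exists s e, M = signed_perm_mx R s e].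

Arguments hyperoctahedral : clear implicits.

Lemma hyperoctahedral_compact (R : realType) (N : nat) :
  compact (hyperoctahedral R N).
Proof.
have -> : hyperoctahedral R N = [set signed_perm_mx R se.1 se.2 |
    se in [set: {perm 'I_N} * {ffun 'I_N -> bool}]].
  apply/seteqP; split=> M; first by move=> [s [e ->]]; exists (s, e).
  by move=> [[s e] _ <-]; exists s, e.
by apply: finite_compact; apply: finite_image; exact: finite_finset.
Qed.

Lemma hyperoctahedral_neq0 (R : realType) (N : nat) :
  hyperoctahedral R N !=set0.
Proof. by exists (signed_perm_mx R 1%g [ffun=> false]), 1%g, [ffun=> false]. Qed.

Record starhom (R : realType) (A B : cstarType R) := StarHom {
  starhom_fun :> {lrmorphism A -> B};
  starhom_star : forall a, starhom_fun (star a) = star (starhom_fun a)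
}.

Inductive star_subalg (R : realType) (A : cstarType R) (I : Type) (x : I -> A) :
    set A :=
| ssa_gen i : star_subalg x (x i)
| ssa_one : star_subalg x 1
| ssa_lin (c : R[i]) a b :
    star_subalg x a -> star_subalg x b -> star_subalg x (c *: a + b)
| ssa_mul a b : star_subalg x a -> star_subalg x b -> star_subalg x (a * b)
| ssa_star a : star_subalg x a -> star_subalg x (star a).

Definition cdense (R : realType) (A : cstarType R) (S : set A) : Prop :=
  forall (a : A) (e : R), 0 < e -> exists2 b, S b & cnorm (a - b) < e.

Definition generates (R : realType) (A : cstarType R) (I : Type) (x : I -> A) :
    Prop :=
  cdense (star_subalg x).

(* C*-completions of the algebraic tensor product of A and B, for an arbitrary
   C*-norm: ctens_inj says that the canonical map from the algebraic tensor
   product, sending a (x) b to ctens_l a * ctens_r b, is injective. *)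
Record ctensor (R : realType) (A B : cstarType R) := CTensor {
  ctens_alg :> cstarType R;
  ctens_l : starhom A ctens_alg;
  ctens_r : starhom B ctens_alg;
  ctens_comm : forall a b, ctens_l a * ctens_r b = ctens_r b * ctens_l a;
  ctens_inj : forall n (a : 'I_n -> A) (b : 'I_n -> B),
    (forall c : 'I_n -> R[i], \sum_i c i *: b i = 0 -> forall i, c i = 0) ->
    \sum_i ctens_l (a i) * ctens_r (b i) = 0 -> forall i, a i = 0;
  ctens_dense : cdense [set t | exists n (a : 'I_n -> A) (b : 'I_n -> B),
    t = \sum_i ctens_l (a i) * ctens_r (b i)]
}.

Definition cpure (R : realType) (A B : cstarType R) (T : ctensor A B)
    (a : A) (b : B) : T :=
  ctens_l T a * ctens_r T b.

Definition tensor_product (R : realType) :=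
  forall A B : cstarType R, ctensor A B.

(* A noncommutative space X with coordinates indexed by I: the algebra C(X) and
   the coordinates in it.  A quotient of a universal C*-algebra generated by
   I-indexed elements amounts to a C*-algebra generated by such elements that
   satisfy the relations, so no separate datum is needed for the quotient map. *)
Record qspace (R : realType) (I : Type) := QSpace {
  calg : cstarType R;
  coord : I -> calg
}.

Definition qincl (R : realType) (I : Type) (X Y : qspace R I) : Prop :=
  exists f : starhom (calg Y) (calg X), forall i, f (coord Y i) = coord X i.

Definition universal (R : realType) (I : Type)
    (rel : forall A : cstarType R, (I -> A) -> Prop) (X : qspace R I) : Prop :=
  [/\ rel (calg X) (coord X),
      generates (coord X)
    & forall (B : cstarType R) (y : I -> B), rel B y ->
      exists f : starhom (calg X) B, forall i, f (coord X i) = y i].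

Section QuantumGroups.
Variables (R : realType) (N : nat).
Local Notation ent := ('I_N * 'I_N)%type.
Local Notation qgrp := (qspace R ('I_N * 'I_N)).

Definition orthogonal_rel (A : cstarType R) (u : ent -> A) : Prop :=
  let U : 'M[A]_N := \matrix_(i, j) u (i, j) in
  [/\ forall p, star (u p) = u p, U *m U^T = 1%:M & U^T *m U = 1%:M].

(* Two positions in an N x N matrix on a common row or column; the entries u_p
   and u_q are regarded as different when p and q are. *)
Definition same_line (p q : ent) : bool := (p.1 == q.1) || (p.2 == q.2).

Definition hyper_infty_rel (A : cstarType R) (u : ent -> A) : Prop :=
  orthogonal_rel u /\
  forall p q r, p != r -> same_line p r -> u p * u q * u r = 0.

Definition hyper_free_rel (A : cstarType R) (u : ent -> A) : Prop :=
  orthogonal_rel u /\ forall p q, p != q -> same_line p q -> u p * u q = 0.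

Definition hyper_half_rel (A : cstarType R) (u : ent -> A) : Prop :=
  hyper_free_rel u /\ forall p q r, u p * u q * u r = u r * u q * u p.

Definition comultiplication (tens : tensor_product R) (G : qgrp)
    (D : starhom (calg G) (tens (calg G) (calg G))) : Prop :=
  forall i j, D (coord G (i, j)) =
    \sum_k cpure _ (coord G (i, k)) (coord G (k, j)).

(* The counit and the antipode are only required on the dense *-subalgebra
   generated by the coordinates, so that non-universal completions, such as the
   reduced ones, are quantum groups as well. *)
Definition counit (G : qgrp) (e : calg G -> R[i]) : Prop :=
  let O := star_subalg (coord G) in
  [/\ e 1 = 1,
      forall c a b, O a -> O b -> e (c *: a + b) = c * e a + e b,
      forall a b, O a -> O b -> e (a * b) = e a * e b,
      forall a, O a -> e (star a) = (e a)^*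
    & forall i j, e (coord G (i, j)) = (i == j)%:R].

Definition antipode (G : qgrp) (S : calg G -> calg G) : Prop :=
  let O := star_subalg (coord G) in
  [/\ S 1 = 1,
      forall c a b, O a -> O b -> S (c *: a + b) = c *: S a + S b,
      forall a b, O a -> O b -> S (a * b) = S b * S a,
      forall a, O a -> S (star a) = star (S a)
    & forall i j, S (coord G (i, j)) = star (coord G (j, i))].

(* Closed quantum subgroups of O_N^+ : quotients of the universal C*-algebra on
   the orthogonality relations to which the quantum group structure factors. *)
Definition closed_qsubgroup (tens : tensor_product R) (G : qgrp) : Prop :=
  [/\ orthogonal_rel (coord G), generates (coord G),
      exists D, @comultiplication tens G D,
      exists e, @counit G e
    & exists S, @antipode G S].

(* As the coordinates generate C(X), the coaction identities for Phi follow from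
   its values on them. *)
Definition affine_action (tens : tensor_product R) (G : qgrp)
    (X : qspace R 'I_N) : Prop :=
  exists Phi : starhom (calg X) (tens (calg G) (calg X)),
    forall i, Phi (coord X i) = \sum_j cpure _ (coord G (i, j)) (coord X j).

(* H is the largest quantum group acting affinely on X and contained in Hinf,
   which stands for H_N^[infty]. *)
Definition qreflection_group (tens : tensor_product R) (Hinf : qgrp)
    (X : qspace R 'I_N) (H : qgrp) : Prop :=
  let P G := [/\ closed_qsubgroup tens G, qincl G Hinf
               & affine_action tens G X] in
  P H /\ forall G, P G -> qincl G H.

Definition hyperoctahedral_group : qgrp :=
  QSpace (@cfun_entry R N N
    (CompactSet (@hyperoctahedral_compact R N) (hyperoctahedral_neq0 R N))).

Definition free_sphere_rel (A : cstarType R) (x : 'I_N -> A) : Prop :=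
  (forall i, star (x i) = x i) /\ \sum_i x i ^+ 2 = 1.

Definition half_sphere_rel (A : cstarType R) (x : 'I_N -> A) : Prop :=
  free_sphere_rel x /\ forall i j k, x i * x j * x k = x k * x j * x i.

Definition infty_sphere_rel (A : cstarType R) (x : 'I_N -> A) : Prop :=
  free_sphere_rel x /\ forall i j, x i ^+ 2 * x j = x j * x i ^+ 2.

Definition real_sphere (N_gt0 : (0 < N)%N) : qspace R 'I_N :=
  let K := CompactSet (@sphere_compact R N) (sphere_neq0 R N_gt0) in
  QSpace (fun i : 'I_N => @cfun_entry R 1 N K (0, i)).

Definition unitary_rep (G : groupType) (A : cstarType R) (pi : G -> A) : Prop :=
  [/\ pi 1%g = 1, forall g h, pi (g * h)%g = pi g * pi h
    & forall g, star (pi g) = pi g^-1%g].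

Definition group_cstar (G : groupType) (U : qspace R G) : Prop :=
  universal (@unitary_rep G) U.

(* The dual of G = <g_1, ..., g_N> in the free sphere, x_i = g_i / sqrt N. *)
Definition dual_cube (G : groupType) (g : 'I_N -> G) (U : qspace R G) :
    qspace R 'I_N :=
  QSpace (fun i => (Num.sqrt (N%:R : R))^-1%:C *: coord U (g i)).

End QuantumGroups.

(* The group generated by involutions indexed by I, subject to the relations
   a = b for r a b; words need no inverse letters. *)
Section InvolutionGroup.
Variables (I : choiceType) (r : seq I -> seq I -> Prop).
Local Open Scope quotient_scope.
Local Notation repr := generic_quotient.repr.

Inductive word_eqv : seq I -> seq I -> Prop :=
| weqv_refl a : word_eqv a a
| weqv_sym a b : word_eqv a b -> word_eqv b a
| weqv_trans a b c : word_eqv a b -> word_eqv b c -> word_eqv a c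
| weqv_cat a a' b b' :
    word_eqv a a' -> word_eqv b b' -> word_eqv (a ++ b) (a' ++ b')
| weqv_invol i : word_eqv [:: i; i] [::]
| weqv_rel a b : r a b -> word_eqv a b.

Definition word_eqb (a b : seq I) : bool := `[< word_eqv a b >].

Lemma word_eqb_refl : reflexive word_eqb.
Proof. by move=> a; apply/asboolP; exact: weqv_refl. Qed.
Lemma word_eqb_sym : symmetric word_eqb.
Proof. by move=> a b; apply/asboolP/asboolP; exact: weqv_sym. Qed.
Lemma word_eqb_trans : transitive word_eqb.
Proof.
by move=> b a c /asboolP ab /asboolP bc; apply/asboolP; exact: weqv_trans bc.
Qed.

Canonical word_equiv :=
  EquivRel word_eqb word_eqb_refl word_eqb_sym word_eqb_trans.

Definition invol_group := {eq_quot word_equiv}.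
HB.instance Definition _ := Choice.on invol_group.
HB.instance Definition _ := EqQuotient.on invol_group.

Definition word_class (a : seq I) : invol_group := \pi_invol_group a.

Lemma word_classP a b : word_class a = word_class b <-> word_eqv a b.
Proof.
split=> [/eqmodP/asboolP //|ab]; apply/eqmodP; exact/asboolP.
Qed.

Lemma word_repr (x : invol_group) : word_class (repr x) = x.
Proof. exact: reprK. Qed.

Lemma weqv_revl a : word_eqv (rev a ++ a) [::].
Proof.
elim: a => [|i a IH]; first exact: weqv_refl.
rewrite rev_cons cat_rcons.
apply: weqv_trans IH; apply: weqv_cat; first exact: weqv_refl.
rewrite -[i :: i :: a]/([:: i; i] ++ a) -[X in word_eqv _ X]/([::] ++ a).
by apply: weqv_cat; [exact: weqv_invol|exact: weqv_refl].
Qed.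

Definition invol_one : invol_group := word_class [::].
Definition invol_mul (x y : invol_group) : invol_group :=
  word_class (repr x ++ repr y).
Definition invol_inv (x : invol_group) : invol_group :=
  word_class (rev (repr x)).

Lemma invol_mulE a b :
  invol_mul (word_class a) (word_class b) = word_class (a ++ b).
Proof.
by apply/word_classP; apply: weqv_cat; apply/word_classP; exact: word_repr.
Qed.

Fact invol_mulA : associative invol_mul.
Proof.
move=> x y z; rewrite -(word_repr x) -(word_repr y) -(word_repr z).
by rewrite !invol_mulE catA.
Qed.
Fact invol_mul1 : left_id invol_one invol_mul.
Proof. by move=> x; rewrite -(word_repr x) invol_mulE. Qed.
Fact invol_mulr1 : right_id invol_one invol_mul.
Proof. by move=> x; rewrite -(word_repr x) invol_mulE cats0. Qed.
Fact invol_mulV : left_inverse invol_one invol_inv invol_mul.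
Proof.
move=> x; rewrite -[X in invol_mul _ X]word_repr invol_mulE.
by apply/word_classP; exact: weqv_revl.
Qed.
Fact invol_mulrV : right_inverse invol_one invol_inv invol_mul.
Proof.
move=> x; rewrite -[X in invol_mul X _]word_repr invol_mulE.
apply/word_classP; rewrite -[X in X ++ _]revK; exact: weqv_revl.
Qed.

HB.instance Definition _ := isGroup.Build invol_group
  invol_mulA invol_mul1 invol_mulr1 invol_mulV invol_mulrV.

Definition invol_gen (i : I) : invol_group := word_class [:: i].

End InvolutionGroup.

Definition Z2_free (N : nat) : groupType :=
  invol_group (fun _ _ : seq 'I_N => False).
Definition Z2_free_gen (N : nat) (i : 'I_N) : Z2_free N := invol_gen _ i.

Definition half_comm (N : nat) (a b : seq 'I_N) : Prop :=
  exists i j k, a = [:: i; j; k] /\ b = [:: k; j; i].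

Definition Z2_half (N : nat) : groupType := invol_group (@half_comm N).
Definition Z2_half_gen (N : nat) (i : 'I_N) : Z2_half N := invol_gen _ i.

Definition Z2_pow (N : nat) : groupType := {dffun forall i : 'I_N, 'Z_2}.
Definition Z2_pow_gen (N : nat) (i : 'I_N) : Z2_pow N :=
  [ffun j => if j == i then Zp1 else Zp0] : {dffun forall i : 'I_N, 'Z_2}.

(* Main.v *)
Require Import Defs.
From HB Require Import structures.
From mathcomp Require Import all_boot all_order all_algebra all_fingroup.
From mathcomp Require Import all_classical all_reals all_analysis.
From mathcomp Require Import complex.

(* Taking b = a in the relations abc = 0 of H_N^[infty] gives ac = 0 for a <> c on
   a common line, by the C*-identity, so each u_ij^2 is a projection, and it is
   central.  If G < H_N^[infty] acts on X, with coaction Phi, then multiplying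
   Phi(x_a) Phi(x_b) Phi(x_c) by u_aj^2 u_bk^2 u_cl^2 leaves the single term
   u_aj u_bk u_cl (x) x_j x_k x_l.  Hence a relation x_a x_b x_c = x_c x_b x_a or
   x_a x_b = x_b x_a passes from X to G as soon as the monomials in the x_i are
   nonzero; this is the maximality.  Existence of the actions, comultiplications,
   counits and antipodes comes from universal properties.  For H_N itself, the
   algebra of functions is universal for the commuting matrices with the relations
   of H_N^+: the products of the row projections (u_ij^2 +- u_ij)/2 form a
   partition of unity indexed by the signed permutations. *)

Set Implicit Arguments.
Unset Strict Implicit.
Unset Printing Implicit Defensive.

Import Order.TTheory GRing.Theory Num.Theory.
Import numFieldNormedType.Exports.

Local Open Scope classical_set_scope.
Local Open Scope ring_scope.
Local Open Scope complex_scope.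

(** * C*-algebras *)

Section CStarBasics.
Variables (R : realType) (A : cstarType R).
Implicit Types a b : A.

Lemma star1 : star 1 = 1 :> A.
Proof. by rewrite -[LHS]mulr1 -[X in _ * X]starK -starM mulr1 starK. Qed.

Lemma star0 : star 0 = 0 :> A.
Proof. by apply: (addrI (star 0)); rewrite -starD !addr0. Qed.

Lemma star_sum (I : Type) (r : seq I) (P : pred I) (F : I -> A) :
  star (\sum_(i <- r | P i) F i) = \sum_(i <- r | P i) star (F i).
Proof. exact: (big_morph _ (@starD R A) star0). Qed.

Lemma star_prod_comm (I : Type) (r : seq I) (F : I -> A) :
  (forall i j, F i * F j = F j * F i) ->
  star (\prod_(i <- r) F i) = \prod_(i <- r) star (F i).
Proof.
move=> FC; elim: r => [|i r IH]; first by rewrite !big_nil star1.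
rewrite !big_cons starM IH; apply/esym; apply: commr_prod => j _.
by rewrite /GRing.comm -!starM FC.
Qed.

Lemma cnorm0 : cnorm (0 : A) = 0.
Proof. by rewrite -(scale0r (0 : A)) cnormZ Normc.normc0 mul0r. Qed.

Lemma star_mul_eq0 a : star a * a = 0 -> a = 0.
Proof.
move=> a0; apply: cnorm_eq0; apply/eqP; rewrite -sqrf_eq0 -cstar_identity a0.
by rewrite cnorm0.
Qed.

End CStarBasics.

(** Homomorphisms are built below as plain functions, mostly finite sums; this is where they receive
    their bundled structure. *)
Lemma starhomP (R : realType) (A B : cstarType R) (f : A -> B) :
  (forall (c : R[i]) a b, f (c *: a + b) = c *: f a + f b) ->
  f 1 = 1 -> (forall a b, f (a * b) = f a * f b) ->
  (forall a, f (star a) = star (f a)) ->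
  exists F : starhom A B, forall a, F a = f a.
Proof.
move=> fL f1 fM fS.
pose m1 := GRing.isLinear.Build R[i] A B _ f fL.
pose m2 := GRing.isMonoidMorphism.Build A B f (conj f1 fM).
pose g : {lrmorphism A -> B} := HB.pack f m1 m2.
by exists (@StarHom R A B g fS).
Qed.

Lemma starhom_comp (R : realType) (A B C : cstarType R)
    (f : starhom A B) (g : starhom B C) :
  exists h : starhom A C, forall a, h a = g (f a).
Proof.
apply: starhomP => [c a b||a b|a].
- by rewrite !linearP.
- by rewrite !rmorph1.
- by rewrite !rmorphM.
- by rewrite !starhom_star.
Qed.

(* The opposite algebra: an antipode on C(G) is a *-homomorphism into it. *)
Definition cstar_op (R : realType) (A : cstarType R) : Type := A.

Section Opposite.
Variables (R : realType) (A : cstarType R).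
Local Notation Ao := (cstar_op A).

HB.instance Definition _ := GRing.NzRing.copy Ao (A^c)%type.
HB.instance Definition _ := GRing.Zmodule_isLmodule.Build R[i] Ao
  (@scalerA _ A) (@scale1r _ A) (@scalerDr _ A) (@scalerDl _ A).

Fact cstar_op_scaleAl (c : R[i]) (a b : Ao) : c *: (a * b) = (c *: a) * b.
Proof. exact: (@scalerAr _ A c b a). Qed.
HB.instance Definition _ :=
  GRing.Lmodule_isLalgebra.Build R[i] Ao cstar_op_scaleAl.

Fact cstar_op_scaleAr (c : R[i]) (a b : Ao) : c *: (a * b) = a * (c *: b).
Proof. exact: (@scalerAl _ A c b a). Qed.
HB.instance Definition _ :=
  GRing.Lalgebra_isAlgebra.Build R[i] Ao cstar_op_scaleAr.

Let star_o : Ao -> Ao := @star R A.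
Let cnorm_o : Ao -> R := @cnorm R A.

Fact cstar_op_starM a b : star_o (a * b) = star_o b * star_o a.
Proof. exact: (@starM R A b a). Qed.
Fact cstar_op_normM a b : cnorm_o (a * b) <= cnorm_o a * cnorm_o b.
Proof. rewrite mulrC; exact: (@cnormM R A b a). Qed.

(** Reversing the product turns the C*-identity into one for [a * star a], so the point is that
    [star] is isometric. Submultiplicativity bounds the norm of [star c * c], which is the square of
    the norm of [c], and dividing by the norm of [c] gives one inequality; involutivity gives the
    other. *)
Fact cstar_op_cstar a : cnorm_o (star_o a * a) = cnorm_o a ^+ 2.
Proof.
have idn (b : A) : cnorm (star b) = cnorm b.
  have [b0|b0] := eqVneq b 0; first by rewrite b0 star0.
  have le (c : A) : c != 0 -> cnorm c <= cnorm (star c).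
    move=> c0; have := cnormM (star c) c; rewrite cstar_identity.
    have : 0 < cnorm c.
      rewrite lt_neqAle eq_sym; apply/andP; split.
        by apply: contra c0 => /eqP/cnorm_eq0 ->.
      (* Nonnegativity of the norm: 0 is the norm of c - c, hence at most twice that of c. *)
      have := cnormD c (- c); rewrite subrr cnorm0 -scaleN1r cnormZ.
      have -> : Normc.normc (-1 : R[i]) = 1.
        by rewrite normcN /= expr0n /= addr0 expr1n sqrtr1.
      by rewrite mul1r -mulr2n pmulrn_lge0.
    by move=> cp; rewrite expr2 ler_pM2r.
  apply/le_anti/andP; split; last exact: le.
  rewrite -{2}(starK b); apply: le.
  by apply: contra b0 => /eqP b0; rewrite -(starK b) b0 star0.
change (cnorm ((a : A) * star (a : A)) = cnorm (a : A) ^+ 2).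
by rewrite -{1}(starK (a : A)) cstar_identity idn.
Qed.

HB.instance Definition _ := Algebra_isCStar.Build R Ao (@starD R A) (@starZ R A)
  cstar_op_starM (@starK R A) (@cnormD R A) (@cnormZ R A) (@cnorm_eq0 R A)
  cstar_op_normM  cstar_op_cstar (@cnorm_complete R A).

Lemma cstar_op_mulE (a b : Ao) : a * b = ((b : A) * (a : A) : A).
Proof. by []. Qed.

End Opposite.

(** * Commuting partitions of unity *)

Section PartitionOfUnity.
Variables (R : realType) (B : cstarType R) (I T : finType) (q : I -> T -> B).
Hypothesis q_comm : forall i s j t, q i s * q j t = q j t * q i s.
Hypothesis q_star : forall i s, star (q i s) = q i s.
Hypothesis q_idem : forall i s t, q i s * q i t = if s == t then q i s else 0.
Hypothesis q_sum : forall i, \sum_s q i s = 1.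
Implicit Types f g : {ffun I -> T}.

(** When the [q i s] are the spectral projections of commuting self-adjoint elements, this is the
    joint spectral projection at the point [f]. *)
Definition joint_proj (f : {ffun I -> T}) : B := \prod_i q i (f i).

Lemma joint_proj_comm b f : (forall i s, b * q i s = q i s * b) ->
  b * joint_proj f = joint_proj f * b.
Proof. by move=> bq; apply: commr_prod => i _; exact: bq. Qed.

(** The idempotent [q i (f i)] already occurs in the product, and it commutes past the factors that
    follow it. *)
Lemma joint_proj_absorb f i : joint_proj f * q i (f i) = joint_proj f.
Proof.
rewrite /joint_proj; have := mem_index_enum i.
elim: (index_enum I) => // j r IH; rewrite inE big_cons => /orP[/eqP->|ir].
  rewrite -mulrA -[X in _ * X = _]commr_prod => [|k _]; last exact: q_comm.
  by rewrite mulrA q_idem eqxx.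
by rewrite -mulrA IH.
Qed.

Lemma joint_proj_eigen f i b (c : R[i]) :
  q i (f i) * b = c *: q i (f i) -> joint_proj f * b = c *: joint_proj f.
Proof.
by move=> qb; rewrite -(joint_proj_absorb f i) -mulrA qb scalerAr.
Qed.

(** If [f] and [g] differ at [i], absorption lets the orthogonal projections [q i (f i)] and
    [q i (g i)] be inserted and brought together. *)
Lemma joint_proj_idem f g :
  joint_proj f * joint_proj g = if f == g then joint_proj f else 0.
Proof.
have [<-|fg] := eqVneq f g.
  rewrite {2}/joint_proj; elim: (index_enum I) => [|i r IH].
    by rewrite big_nil mulr1.
  by rewrite big_cons mulrA joint_proj_absorb.
have [i fgi] : exists i, f i != g i.
  apply/existsP; rewrite -negb_forall; apply: contra fg => /forallP fg.
  by apply/eqP/ffunP => i; apply/eqP.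
rewrite -(joint_proj_absorb f i) -mulrA joint_proj_comm => [|*];
  last exact: q_comm.
rewrite -(joint_proj_absorb g i) -mulrA (q_comm i (g i)) q_idem (negPf fgi).
by rewrite !mulr0.
Qed.

(** Distributivity: a product of sums, each equal to 1, expands into one term for every choice
    function [f]. *)
Lemma joint_proj_sum : \sum_f joint_proj f = 1.
Proof. by rewrite -bigA_distr_bigA big1 // => i _; exact: q_sum. Qed.

Lemma joint_proj_star f : star (joint_proj f) = joint_proj f.
Proof.
by rewrite star_prod_comm => [|i j]; [apply: eq_bigr|exact: q_comm].
Qed.

(** A block-diagonal sum. Orthogonality of the projections kills the cross terms of a product, and
    commutation with the image of [phi f] makes each block multiplicative and compatible with
    [star]. *)
Lemma starhom_glue (A : cstarType R) (phi : {ffun I -> T} -> starhom A B) :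
  (forall f a, joint_proj f * phi f a = phi f a * joint_proj f) ->
  exists F : starhom A B, forall a, F a = \sum_f joint_proj f * phi f a.
Proof.
move=> phiC; apply: starhomP => [c a b||a b|a].
- rewrite scaler_sumr -big_split; apply: eq_bigr => f _.
  by rewrite linearP mulrDr scalerAr.
- by rewrite -joint_proj_sum; apply: eq_bigr => f _; rewrite rmorph1 mulr1.
- rewrite mulr_suml; apply: eq_bigr => f _; rewrite mulr_sumr (bigD1 f) //=.
  rewrite big1 ?addr0 => [|g gf].
    rewrite mulrA -(mulrA _ (phi f a)) -phiC (mulrA _ _ (phi f a)).
    by rewrite joint_proj_idem eqxx rmorphM mulrA.
  rewrite mulrA phiC -(mulrA (phi f a)) joint_proj_idem eq_sym (negPf gf).
  by rewrite mulr0 mul0r.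
- rewrite star_sum; apply: eq_bigr => f _.
  by rewrite starhom_star starM joint_proj_star -starhom_star phiC.
Qed.

End PartitionOfUnity.

Lemma starhom_eval (R : realType) (T : topologicalType) (K : compact_set T)
    (B : cstarType R) (x : set_type K) :
  exists F : starhom (cfun R K) B, forall f, F f = (f x)%:A.
Proof.
apply: starhomP => [c f g||f g|f].
- by rewrite cfun_addE cfun_scaleE scalerDl scalerA.
- by rewrite scale1r.
- by rewrite cfun_mulE -scalerAl mul1r scalerA.
- by rewrite starZ star1.
Qed.

Section JointSpectrum.
Variables (R : realType) (B : cstarType R) (I T : finType) (q : I -> T -> B).
Hypothesis q_comm : forall i s j t, q i s * q j t = q j t * q i s.
Hypothesis q_star : forall i s, star (q i s) = q i s.
Hypothesis q_idem : forall i s t, q i s * q i t = if s == t then q i s else 0.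
Hypothesis q_sum : forall i, \sum_s q i s = 1.
Variables (X : topologicalType) (K : compact_set X).
Variable x : {ffun I -> T} -> set_type K.

(** Functional calculus with finite joint spectrum, obtained by gluing the evaluations at the points
    [x f]. *)
Lemma starhom_joint_eval :
  exists F : starhom (cfun R K) B, forall h, F h = \sum_f h (x f) *: joint_proj q f.
Proof.
have [phi phiE] := choice (fun f => starhom_eval B (x f)).
have [|F FE] := starhom_glue (phi := phi) q_comm q_star q_idem q_sum.
  by move=> f a; rewrite phiE -scalerAl mul1r -scalerAr mulr1.
exists F => h; rewrite FE; apply: eq_bigr => f _.
by rewrite phiE -scalerAr mulr1.
Qed.

(** As the joint projections sum to 1, the value of [F] at [h] can be identified on each of them
    separately. *)
Lemma starhom_joint_eval_eigen (F : starhom (cfun R K) B) (h : cfun R K) b :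
  (forall h, F h = \sum_f h (x f) *: joint_proj q f) ->
  (forall f, joint_proj q f * b = h (x f) *: joint_proj q f) -> F h = b.
Proof.
move=> FE hb; rewrite FE -[RHS]mul1r -(joint_proj_sum q_sum) mulr_suml.
by apply: eq_bigr => f _; rewrite hb.
Qed.

End JointSpectrum.

(** * Relations between the coordinates of a reflection group *)

Section MixedProducts.
Variables (A : nzRingType) (J : finType).
Implicit Types u v w x y z : J -> A.

(** Here [u] and [v] stand for the left leg of a tensor product, [x] and [y] for the right leg; only
    the inner factors are exchanged. *)
Lemma mixed_mul2 u v x y : (forall i j, v i * x j = x j * v i) ->
  (\sum_i u i * x i) * (\sum_j v j * y j) =
  \sum_i \sum_j (u i * v j) * (x i * y j).
Proof.
move=> vx; rewrite mulr_suml; apply: eq_bigr => i _; rewrite mulr_sumr.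
by apply: eq_bigr => j _; rewrite -!mulrA; congr (_ * _); rewrite !mulrA vx.
Qed.

Lemma mixed_mul3 u v w x y z :
  (forall i j, v i * x j = x j * v i) -> (forall i j, w i * x j = x j * w i) ->
  (forall i j, w i * y j = y j * w i) ->
  (\sum_i u i * x i) * (\sum_j v j * y j) * (\sum_k w k * z k) =
  \sum_i \sum_j \sum_k (u i * v j * w k) * (x i * y j * z k).
Proof.
move=> vx wx wy; rewrite mixed_mul2 // mulr_suml; apply: eq_bigr => i _.
rewrite mulr_suml; apply: eq_bigr => j _; rewrite mulr_sumr.
apply: eq_bigr => k _; rewrite -!mulrA; congr (_ * (_ * _)).
by rewrite [RHS]mulrA wx -mulrA [w k * (_ * _)]mulrA wy -mulrA.
Qed.

End MixedProducts.

(** A presentation of the algebra of functions on the classical group; [hyperoctahedral_universal]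
    shows that it is the right one. *)
Definition hyper_class_rel (R : realType) (N : nat) (A : cstarType R)
    (u : 'I_N * 'I_N -> A) : Prop :=
  hyper_free_rel u /\ forall p q, u p * u q = u q * u p.

Section Relations.
Variables (R : realType) (N : nat).
Local Notation ent := ('I_N * 'I_N)%type.

Section OneMatrix.
Variables (A : cstarType R) (u : ent -> A).

Lemma orthogonal_relP : orthogonal_rel u <->
  [/\ forall p, star (u p) = u p,
      forall i k, \sum_j u (i, j) * u (k, j) = (i == k)%:R
    & forall i k, \sum_j u (j, i) * u (j, k) = (i == k)%:R].
Proof.
split=> [[us /matrixP ur /matrixP uc]|[us ur uc]]; split=> //.
- move=> i k; have := ur i k; rewrite !mxE => <-.
  by apply: eq_bigr => j _; rewrite !mxE.
- move=> i k; have := uc i k; rewrite !mxE => <-.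
  by apply: eq_bigr => j _; rewrite !mxE.
- by apply/matrixP => i k; rewrite !mxE -ur; apply: eq_bigr => j _; rewrite !mxE.
- by apply/matrixP => i k; rewrite !mxE -uc; apply: eq_bigr => j _; rewrite !mxE.
Qed.

Lemma infty_free : hyper_infty_rel u -> hyper_free_rel u.
Proof.
move=> [uo ui]; split=> // p q pq pql; apply: star_mul_eq0.
have [us _ _] := uo; rewrite starM !us -mulrA (mulrA (u p)) ui // mulr0 //.
Qed.

(** In [star (a * b * c) * (a * b * c)], rewriting the second factor as [c * b * a] puts [a] next to
    [c], and their product vanishes on a common line. *)
Lemma half_infty : hyper_half_rel u -> hyper_infty_rel u.
Proof.
move=> [[uo uf] uh]; split=> // p q r pr prl; apply: star_mul_eq0.
have [us _ _] := uo; rewrite !starM !us (uh p q r) -!mulrA (mulrA (u p)).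
by rewrite uf // mul0r !mulr0.
Qed.

Lemma class_half : hyper_class_rel u -> hyper_half_rel u.
Proof.
move=> [uf uC]; split=> // p q r.
by rewrite (uC p q) -mulrA (uC p r) mulrA (uC q r).
Qed.

Lemma class_infty : hyper_class_rel u -> hyper_infty_rel u.
Proof. by move=> /class_half/half_infty. Qed.

Section Free.
Hypothesis uf : hyper_free_rel u.

Lemma free_mul_row i j k : j != k -> u (i, j) * u (i, k) = 0.
Proof.
by move=> jk; apply: uf.2; rewrite ?xpair_eqE ?eqxx //= /same_line eqxx.
Qed.

Lemma free_mul_col i j k : i != k -> u (i, j) * u (k, j) = 0.
Proof.
move=> ik; apply: uf.2; rewrite ?xpair_eqE ?eqxx ?andbT //.
by rewrite /same_line eqxx orbT.
Qed.

Lemma free_row_sum i : \sum_k u (i, k) * u (i, k) = 1.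
Proof. by have /orthogonal_relP[_ -> _] := uf.1; rewrite eqxx. Qed.

(** Multiplying [u (i, j)] by the row sum 1 leaves only its own square, so the cube of an entry is
    the entry itself and its square is a projection. *)
Lemma free_sqr_mul i j k :
  u (i, j) * u (i, j) * u (i, k) = if j == k then u (i, j) else 0.
Proof.
case: eqVneq => [<-|jk]; last by rewrite -mulrA free_mul_row // mulr0.
rewrite -[RHS]mul1r -(free_row_sum i) mulr_suml (bigD1 j) //= big1 ?addr0 // => l lj.
by rewrite -mulrA free_mul_row // mulr0.
Qed.

End Free.

(** With P_k the square of [u (i, k)], the products P_j [u q] P_k and P_k [u q] P_j contain a
    vanishing monomial for k different from j. As the P_k sum to 1, both sides equal P_j [u q]
    P_j. *)
Lemma infty_sqr_central p q : hyper_infty_rel u ->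
  u p * u p * u q = u q * (u p * u p).
Proof.
move=> ui; have uf := infty_free ui; case: p => i j.
have sl k : same_line (i, j) (i, k) by rewrite /same_line eqxx.
have ne k : k != j -> (i, j) != (i, k) by rewrite eq_sym xpair_eqE eqxx.
transitivity (u (i, j) * u (i, j) * u q * (u (i, j) * u (i, j))).
  rewrite -[LHS]mulr1 -(free_row_sum uf i) mulr_sumr (bigD1 j) //=.
  rewrite [X in _ + X]big1 ?addr0 // => k kj.
  by rewrite -(mulrA (u (i, j))) mulrA -(mulrA _ (_ * _)) ui.2 ?ne // mulr0 mul0r.
rewrite -[RHS]mul1r -(free_row_sum uf i) mulr_suml (bigD1 j) //=.
rewrite [X in _ + X]big1 ?addr0 ?mulrA // => k kj.
rewrite -!mulrA (mulrA (u q)) (mulrA (u (i, k)) (u q * _)) (mulrA (u (i, k)) (u q)).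
by rewrite ui.2 ?mul0r ?mulr0 // ?/same_line ?eqxx // xpair_eqE eqxx.
Qed.

End OneMatrix.

(** * Stability of the relations under homomorphisms, matrix products and transposition *)

Definition rel_functorial
    (rel : forall A : cstarType R, (ent -> A) -> Prop) : Prop :=
  forall (A B : cstarType R) (f : starhom A B) u, rel A u -> rel B (fun p => f (u p)).

Definition mul_entry (A : cstarType R) (u v : ent -> A) (p : ent) : A :=
  \sum_k u (p.1, k) * v (k, p.2).

(** Applied to the two copies of [u] in a tensor square, this yields the comultiplication on a
    universal algebra. *)
Definition rel_multiplicative
    (rel : forall A : cstarType R, (ent -> A) -> Prop) : Prop :=
  forall (A : cstarType R) (u v : ent -> A),
    (forall p q, u p * v q = v q * u p) -> rel A u -> rel A v ->
    rel A (mul_entry u v).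

(** An antipode sends u_ij to u_ji, which is self-adjoint here, so this stability yields the
    antipode on a universal algebra. *)
Definition rel_transpose
    (rel : forall A : cstarType R, (ent -> A) -> Prop) : Prop :=
  forall (A : cstarType R) (u : ent -> A), rel A u ->
    rel (cstar_op A) (fun p => u (p.2, p.1) : cstar_op A).

Lemma orthogonal_functorial : rel_functorial (@orthogonal_rel R N).
Proof.
move=> A B f u /orthogonal_relP[us ur uc]; apply/orthogonal_relP; split=> [p|i k|i k].
- by rewrite -starhom_star us.
- by under eq_bigr do rewrite -rmorphM; rewrite -rmorph_sum ur rmorph_nat.
- by under eq_bigr do rewrite -rmorphM; rewrite -rmorph_sum uc rmorph_nat.
Qed.

Lemma infty_functorial : rel_functorial (@hyper_infty_rel R N).
Proof.
move=> A B f u [uo ui]; split=> [|p q r pr prl]; first exact: orthogonal_functorial.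
by rewrite -!rmorphM ui // rmorph0.
Qed.

Lemma free_functorial : rel_functorial (@hyper_free_rel R N).
Proof.
move=> A B f u [uo ui]; split=> [|p q pq pql]; first exact: orthogonal_functorial.
by rewrite -!rmorphM ui // rmorph0.
Qed.

Lemma half_functorial : rel_functorial (@hyper_half_rel R N).
Proof.
move=> A B f u [uf uh]; split=> [|p q r]; first exact: free_functorial.
by rewrite -!rmorphM uh.
Qed.

Lemma class_functorial : rel_functorial (@hyper_class_rel R N).
Proof.
move=> A B f u [uf uC]; split=> [|p q]; first exact: free_functorial.
by rewrite -!rmorphM uC.
Qed.

Lemma orthogonal_multiplicative : rel_multiplicative (@orthogonal_rel R N).
Proof.
move=> A u v uv /orthogonal_relP[us ur uc] /orthogonal_relP[vs vr vc].
apply/orthogonal_relP; split=> [p|i k|i k].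
- by rewrite star_sum; apply: eq_bigr => k _; rewrite starM us vs uv.
- rewrite /mul_entry /=; under eq_bigr do rewrite mixed_mul2 //.
  (* Summing over the column index first, the row relation of [v] collapses the double sum to its
     diagonal. *)
  rewrite exchange_big -ur; apply: eq_bigr => a _ /=; rewrite exchange_big /=.
  under eq_bigr do rewrite -mulr_sumr vr.
  rewrite (bigD1 a) //= eqxx mulr1 big1 ?addr0 // => b /negPf ba.
  by rewrite eq_sym ba mulr0.
- rewrite /mul_entry /=; under eq_bigr do rewrite mixed_mul2 //.
  rewrite exchange_big -vc; apply: eq_bigr => a _ /=; rewrite exchange_big /=.
  under eq_bigr do rewrite -mulr_suml uc.
  rewrite (bigD1 a) //= eqxx mul1r big1 ?addr0 // => b /negPf ba.
  by rewrite eq_sym ba mul0r.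
Qed.

(** Every term of the expanded triple product vanishes. For outer factors on one row, distinct
    summation indices give two entries of [u] on one row, and equal ones give two entries of [v] on
    one row; columns are symmetric, with [u] and [v] exchanged. *)
Lemma infty_multiplicative : rel_multiplicative (@hyper_infty_rel R N).
Proof.
move=> A u v uv [uo ui] [vo vi]; split; first exact: orthogonal_multiplicative.
move=> [a b] [c d] [e f] pr prl; rewrite /mul_entry /= mixed_mul3 //.
rewrite big1 // => i _; rewrite big1 // => j _; rewrite big1 // => k _.
move: prl; rewrite /same_line /= => /orP[/eqP ae|/eqP bf]; subst.
- have [<-|ik] := eqVneq i k.
    rewrite vi ?mulr0 // /same_line ?eqxx //.
    by apply: contra pr; rewrite !xpair_eqE !eqxx.
  by rewrite ui ?mul0r // /same_line /= ?eqxx // xpair_eqE eqxx.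
- have [<-|ik] := eqVneq i k.
    rewrite ui ?mul0r // /same_line ?eqxx ?orbT //.
    by apply: contra pr; rewrite !xpair_eqE !eqxx !andbT.
  by rewrite vi ?mulr0 // /same_line /= ?eqxx ?orbT // xpair_eqE eqxx andbT.
Qed.

Lemma free_multiplicative : rel_multiplicative (@hyper_free_rel R N).
Proof.
move=> A u v uv [uo ui] [vo vi]; split; first exact: orthogonal_multiplicative.
move=> [a b] [e f] pr prl; rewrite /mul_entry /= mixed_mul2 //.
rewrite big1 // => i _; rewrite big1 // => k _.
move: prl; rewrite /same_line /= => /orP[/eqP ae|/eqP bf]; subst.
- have [<-|ik] := eqVneq i k.
    rewrite vi ?mulr0 // /same_line ?eqxx //.
    by apply: contra pr; rewrite !xpair_eqE !eqxx.
  by rewrite ui ?mul0r // /same_line /= ?eqxx // xpair_eqE eqxx.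
- have [<-|ik] := eqVneq i k.
    rewrite ui ?mul0r // /same_line ?eqxx ?orbT //.
    by apply: contra pr; rewrite !xpair_eqE !eqxx !andbT.
  by rewrite vi ?mulr0 // /same_line /= ?eqxx ?orbT // xpair_eqE eqxx andbT.
Qed.

Lemma half_multiplicative : rel_multiplicative (@hyper_half_rel R N).
Proof.
move=> A u v uv [uf uh] [vf vh]; split; first exact: free_multiplicative.
move=> p q r; rewrite /mul_entry !mixed_mul3 //.
(* The three summations are put in reverse order, so that the term for (i, j, k) meets the one for
   (k, j, i). *)
under eq_bigr do rewrite exchange_big; rewrite exchange_big /=.
apply: eq_bigr => k _; rewrite exchange_big; apply: eq_bigr => j _.
by apply: eq_bigr => i _; rewrite uh vh.
Qed.

Lemma class_multiplicative : rel_multiplicative (@hyper_class_rel R N).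
Proof.
move=> A u v uv [uf uC] [vf vC]; split; first exact: free_multiplicative.
move=> p q; rewrite /mul_entry !mixed_mul2 // exchange_big /=.
by apply: eq_bigr => i _; apply: eq_bigr => j _; rewrite uC vC.
Qed.

Lemma same_line_sym (p q : ent) : same_line p q = same_line q p.
Proof. by rewrite /same_line eq_sym [p.2 == _]eq_sym. Qed.

Lemma same_line_swap (p q : ent) :
  same_line (p.2, p.1) (q.2, q.1) = same_line p q.
Proof. by rewrite /same_line orbC. Qed.

Lemma swap_eq (p q : ent) : ((p.2, p.1) == (q.2, q.1)) = (p == q).
Proof. by case: p q => [a b] [c d]; rewrite !xpair_eqE andbC. Qed.

Lemma orthogonal_transpose : rel_transpose (@orthogonal_rel R N).
Proof.
move=> A u /orthogonal_relP[us ur uc].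
apply/orthogonal_relP; split=> [p|i k|i k]; first exact: us.
- by rewrite eq_sym -[RHS]uc.
- by rewrite eq_sym -[RHS]ur.
Qed.

(** The opposite product reverses a monomial and transposition swaps rows with columns; the
    relations are symmetric under both. *)
Lemma infty_transpose : rel_transpose (@hyper_infty_rel R N).
Proof.
move=> A u [uo ui]; split=> [|p q r pr prl]; first exact: orthogonal_transpose.
rewrite !cstar_op_mulE mulrA; apply: ui; first by rewrite swap_eq eq_sym.
by rewrite same_line_swap same_line_sym.
Qed.

Lemma free_transpose : rel_transpose (@hyper_free_rel R N).
Proof.
move=> A u [uo ui]; split=> [|p r pr prl]; first exact: orthogonal_transpose.
rewrite !cstar_op_mulE; apply: ui; first by rewrite swap_eq eq_sym.
by rewrite same_line_swap same_line_sym.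
Qed.

Lemma half_transpose : rel_transpose (@hyper_half_rel R N).
Proof.
move=> A u [uf uh]; split=> [|p q r]; first exact: free_transpose.
by rewrite !cstar_op_mulE !mulrA -uh.
Qed.

Lemma class_transpose : rel_transpose (@hyper_class_rel R N).
Proof.
move=> A u [uf uC]; split=> [|p q]; first exact: free_transpose.
by rewrite !cstar_op_mulE uC.
Qed.

End Relations.

(** * Universality of the function algebra of H_N *)

Section StarSubalgebra.
Variables (R : realType) (A : cstarType R) (I : Type) (x : I -> A).
Local Notation S := (star_subalg x).

Lemma star_subalg0 : S 0.
Proof. by rewrite -(subrr 1) -scaleN1r addrC; do 2?constructor. Qed.

Lemma star_subalgD a b : S a -> S b -> S (a + b).
Proof. by move=> Sa Sb; rewrite -(scale1r a); apply: ssa_lin. Qed.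

Lemma star_subalgZ c a : S a -> S (c *: a).
Proof.
by move=> Sa; rewrite -[c *: a]addr0; apply: ssa_lin => //; exact: star_subalg0.
Qed.

Lemma star_subalg_sum (J : finType) (F : J -> A) :
  (forall j, S (F j)) -> S (\sum_j F j).
Proof.
by move=> SF; apply: (big_ind S) => //; [exact: star_subalg0|exact: star_subalgD].
Qed.

Lemma star_subalg_prod (J : finType) (F : J -> A) :
  (forall j, S (F j)) -> S (\prod_j F j).
Proof. by move=> SF; apply: (big_ind S) => //; [exact: ssa_one|exact: ssa_mul]. Qed.

End StarSubalgebra.

Section SignedRows.
Variables (R : realType) (N : nat) (B : cstarType R) (u : 'I_N * 'I_N -> B).
Hypothesis uR : hyper_class_rel u.

Let uf : hyper_free_rel u := uR.1.
Let uC p q : u p * u q = u q * u p := uR.2 p q.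

Lemma half_scale (b : B) : 2^-1 *: (b + b) = b.
Proof.
by rewrite -mulr2n -[b *+ 2]scaler_nat scalerA mulVf ?scale1r // pnatr_eq0.
Qed.

(* The joint spectral projection of [u (i, j)] at [(-1) ^+ b], for [t = (j, b)]. *)
Definition row_proj (i : 'I_N) (t : 'I_N * bool) : B :=
  2^-1 *: (u (i, t.1) * u (i, t.1) + (-1) ^+ t.2 *: u (i, t.1)).

(** An entry equals its own cube, so multiplying by it interchanges the two terms of [row_proj] up
    to the sign; the other entries of the row are annihilated. *)
Lemma row_proj_mul i t k :
  row_proj i t * u (i, k) =
  (if k == t.1 then (-1) ^+ t.2 else 0) *: row_proj i t.
Proof.
case: t => j b; rewrite /row_proj /= -scalerAl mulrDl free_sqr_mul // eq_sym.
have [->|kj] := eqVneq k j.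
  rewrite [RHS]scalerA [_ * 2^-1]mulrC -[RHS]scalerA; congr (_ *: _).
  by rewrite scalerDr scalerA -signr_addb addbb scale1r -scalerAl addrC.
by rewrite -scalerAl free_mul_row 1?eq_sym // scaler0 addr0 scaler0 scale0r.
Qed.

Lemma row_proj_comm_u i t p : u p * row_proj i t = row_proj i t * u p.
Proof.
rewrite /row_proj -scalerAl -scalerAr; congr (_ *: _).
rewrite mulrDl mulrDr -scalerAl -scalerAr (uC p); congr (_ + _).
by rewrite mulrA uC -mulrA uC mulrA.
Qed.

Lemma row_proj_comm i s j t : row_proj i s * row_proj j t = row_proj j t * row_proj i s.
Proof.
have C p := row_proj_comm_u j t p; move: (row_proj j t) C => z C.
rewrite /row_proj -scalerAl -scalerAr mulrDl mulrDr -scalerAl -scalerAr C.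
by rewrite -mulrA C mulrA C mulrA.
Qed.

Lemma row_proj_star i t : star (row_proj i t) = row_proj i t.
Proof.
have [us _ _] := uf.1.
rewrite /row_proj starZ starD starM starZ !us; congr (_ *: (_ + _ *: _)).
  by rewrite fmorphV rmorph_nat.
by rewrite rmorph_sign.
Qed.

(** The second projection is expanded and the eigenvalue relation of the first applied: different
    columns give 0, equal columns give two terms that add up or cancel according to the signs. *)
Lemma row_proj_idem i s t :
  row_proj i s * row_proj i t = if s == t then row_proj i s else 0.
Proof.
have E := row_proj_mul i s; move: (row_proj i s) E => z E.
rewrite /row_proj -scalerAr mulrDr mulrA -scalerAr !E -scalerAl E.
case: s t {E} => [j b] [k c] /=; rewrite xpair_eqE eq_sym.
case: eqVneq => [_|_] /=; last by rewrite !scale0r !scaler0 addr0 scaler0.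
rewrite !scalerA -!signr_addb addbb.
case: b c => [] [] /=; rewrite ?scaleN1r !scale1r ?subrr ?scaler0 //.
  exact: half_scale.
exact: half_scale.
Qed.

Lemma row_proj_sum i : \sum_t row_proj i t = 1.
Proof.
rewrite -(free_row_sum uf i) -(pair_bigA _ (fun j b => row_proj i (j, b))) /=.
apply: eq_bigr => j _; rewrite big_bool /row_proj /= -scalerDr expr0 expr1.
by rewrite scale1r scaleN1r addrACA addNr addr0 half_scale.
Qed.

(** If two rows select the same column, the product contains two different entries of that column.
    Hence only the [f] that encode signed permutations survive. *)
Lemma joint_row_proj0 (f : {ffun 'I_N -> 'I_N * bool}) :
  ~ injective (fun i => (f i).1) -> joint_proj row_proj f = 0.
Proof.
move=> /injectiveP/injectivePn[i [k ik fik]].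
rewrite -(joint_proj_absorb row_proj_comm row_proj_idem f i) /=.
rewrite -(joint_proj_absorb row_proj_comm row_proj_idem f k) -mulrA.
suff -> : row_proj k (f k) * row_proj i (f i) = 0 by rewrite mulr0.
rewrite [row_proj i (f i)]/row_proj -scalerAr mulrDr mulrA -scalerAr fik.
suff -> : row_proj k (f k) * u (i, (f k).1) = 0 by rewrite mul0r scaler0 addr0 scaler0.
rewrite /row_proj -scalerAl mulrDl -scalerAl -mulrA.
by rewrite !free_mul_col 1?eq_sym // mulr0 scaler0 addr0 scaler0.
Qed.

Lemma joint_row_proj_mul (f : {ffun 'I_N -> 'I_N * bool}) i k :
  joint_proj row_proj f * u (i, k) =
  (if k == (f i).1 then (-1) ^+ (f i).2 else 0) *: joint_proj row_proj f.
Proof.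
by apply: (joint_proj_eigen row_proj_comm row_proj_idem (i := i)); exact: row_proj_mul.
Qed.

End SignedRows.

Section ClassicalHyperoctahedral.
Variables (R : realType) (N : nat).
Local Notation K :=
  (CompactSet (@hyperoctahedral_compact R N) (hyperoctahedral_neq0 R N)).
Local Notation H := (hyperoctahedral_group R N).
Local Notation u := (Defs.coord H).

Lemma hyperoctahedral_point (M : 'M[R]_N) :
  hyperoctahedral R N M -> exists x : set_type K, val x = M.
Proof. by move=> HM; exists (exist _ M (mem_set HM)). Qed.

Lemma cfun_sumE (T : topologicalType) (L : compact_set T) (J : finType)
    (F : J -> cfun R L) x : (\sum_j F j) x = \sum_j F j x.
Proof. exact: (big_morph (fun f : cfun R L => f x)). Qed.

Lemma cfun_natE (T : topologicalType) (L : compact_set T) (b : bool) x :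
  (b%:R : cfun R L) x = b%:R.
Proof. by case: b. Qed.

Lemma signed_perm_row (s : {perm 'I_N}) (e : {ffun 'I_N -> bool}) i k :
  \sum_j signed_perm_mx R s e i j * signed_perm_mx R s e k j = (i == k)%:R.
Proof.
rewrite (bigD1 (s i)) //= big1 ?addr0 => [|j /negPf ji]; last by rewrite !mxE ji mul0r.
rewrite !mxE eqxx (inj_eq perm_inj); case: eqVneq => [->|_]; last by rewrite mulr0.
by rewrite -signr_addb addbb.
Qed.

Lemma signed_perm_col (s : {perm 'I_N}) (e : {ffun 'I_N -> bool}) i k :
  \sum_j signed_perm_mx R s e j i * signed_perm_mx R s e j k = (i == k)%:R.
Proof.
rewrite (bigD1 ((s^-1)%g i)) //= big1 ?addr0 => [|j ji]; last first.
  rewrite !mxE; case: eqP => [iE|_]; last by rewrite mul0r.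
  by move: ji; rewrite iE permK eqxx.
rewrite !mxE permKV eqxx eq_sym; case: eqVneq => [->|_]; last by rewrite mulr0.
by rewrite -signr_addb addbb.
Qed.

Lemma hyperoctahedral_rel : hyper_class_rel u.
Proof.
have pt (x : set_type K) : exists s e, val x = signed_perm_mx R s e.
  by have := set_mem (valP x).
split; last by move=> p q; apply: cfunP => x /=; rewrite mulrC.
split.
  apply/orthogonal_relP; split=> [p|i k|i k]; apply: cfunP => x.
  - exact: conjc_real.
  - rewrite cfun_sumE cfun_natE; have [s [e xE]] := pt x.
    rewrite -(rmorph_nat (real_complex R)) -(signed_perm_row s e) rmorph_sum.
    by apply: eq_bigr => j _; rewrite rmorphM /= xE.
  - rewrite cfun_sumE cfun_natE; have [s [e xE]] := pt x.
    rewrite -(rmorph_nat (real_complex R)) -(signed_perm_col s e) rmorph_sum.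
    by apply: eq_bigr => j _; rewrite rmorphM /= xE.
move=> [a b] [c d] pq pl; apply: cfunP => x; have [s [e xE]] := pt x.
rewrite cfun_mulE /= xE -rmorphM /= !mxE.
case: eqP => [bE|_]; last by rewrite mul0r.
case: eqP => [dE|_]; last by rewrite mulr0.
move: pq pl; rewrite bE dE /same_line /= xpair_eqE (inj_eq perm_inj) andbb orbb.
by move=> /negPf ->.
Qed.

(** When the columns of [f] repeat, an arbitrary point serves as default value, since the joint
    projection at [f] then vanishes. *)
Lemma row_point (f : {ffun 'I_N -> 'I_N * bool}) : exists x : set_type K,
  injective (fun i => (f i).1) ->
  forall i j, val x i j = if j == (f i).1 then (-1) ^+ (f i).2 else 0.
Proof.
have [fI|fI] := pselect (injective (fun i => (f i).1)); last first.
  have [M HM] := hyperoctahedral_neq0 R N; have [x _] := hyperoctahedral_point HM.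
  by exists x.
have [|x xE] := @hyperoctahedral_point
  (signed_perm_mx R (perm fI) [ffun i => (f i).2]); first by do 2 eexists.
by exists x => _ i j; rewrite xE mxE permE ffunE.
Qed.

Lemma row_point_eigen (B : cstarType R) (v : 'I_N * 'I_N -> B)
    (x : {ffun 'I_N -> 'I_N * bool} -> set_type K) :
  hyper_class_rel v ->
  (forall f : {ffun 'I_N -> 'I_N * bool}, injective (fun i => (f i).1) ->
    forall i j, val (x f) i j = if j == (f i).1 then (-1) ^+ (f i).2 else 0) ->
  forall f p,
    joint_proj (row_proj v) f * v p = u p (x f) *: joint_proj (row_proj v) f.
Proof.
move=> vR xE f [i k].
have [fI|fI] := pselect (injective (fun i => (f i).1)); last first.
  by rewrite (joint_row_proj0 vR fI) mul0r scaler0.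
rewrite (joint_row_proj_mul vR) /= (xE f fI); congr (_ *: _).
by case: ifP => _; rewrite ?rmorph_sign ?rmorph0.
Qed.

(** A function on this finite set is interpolated by the joint projections of the coordinates, hence
    is a polynomial in them. Conversely, the relations in [B] provide joint projections on which
    functions can be evaluated. *)
Lemma hyperoctahedral_universal : universal (@hyper_class_rel R N) H.
Proof.
have [x xE] := choice row_point.
have uR := hyperoctahedral_rel.
split=> //.
  move=> a e e0; exists a; last by rewrite subrr cnorm0.
  have -> : a = \sum_f a (x f) *: joint_proj (row_proj u) f.
    apply: cfunP => y; rewrite cfun_sumE -[LHS]mulr1.
    rewrite -[X in _ * X]/((1 : cfun R K) y) -(joint_proj_sum (row_proj_sum uR)).
    rewrite cfun_sumE mulr_sumr; apply: eq_bigr => f _; rewrite cfun_scaleE.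
    (* At a point [y] where this projection is nonzero, the eigenvalue relations force [y] and [x f]
       to have the same entries. *)
    have [->|pf] := eqVneq (joint_proj (row_proj u) f y) 0; first by rewrite !mulr0.
    congr (a _ * _); apply: val_inj; apply/matrixP => i k.
    apply: (fmorph_inj (real_complex R)); apply: (mulfI pf).
    have := congr1 (fun h : cfun R K => h y) (row_point_eigen uR xE f (i, k)).
    by rewrite /= mulrC => ->; rewrite mulrC.
  apply: star_subalg_sum => f; apply: star_subalgZ; apply: star_subalg_prod => i.
  apply: star_subalgZ; apply: star_subalgD.
    by apply: ssa_mul; exact: ssa_gen.
  by apply: star_subalgZ; exact: ssa_gen.
move=> B v vR.
have [F FE] := starhom_joint_eval (row_proj_comm vR) (row_proj_star vR)
  (row_proj_idem vR) (row_proj_sum vR) x.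
exists F => p; apply: (starhom_joint_eval_eigen (row_proj_sum vR) FE) => f.
exact: row_point_eigen.
Qed.

End ClassicalHyperoctahedral.

(** * Affine actions and maximality *)

(** The structure maps come from three models of [rel]: the product of two commuting copies of [u],
    the classical group, and the transpose in the opposite algebra. *)
Lemma closed_qsubgroup_universal (R : realType) (tens : tensor_product R) (N : nat)
    (rel : forall A : cstarType R, ('I_N * 'I_N -> A) -> Prop)
    (H : qspace R ('I_N * 'I_N)) :
  (forall (A : cstarType R) (u : 'I_N * 'I_N -> A), rel A u -> orthogonal_rel u) ->
  (forall (A : cstarType R) (u : 'I_N * 'I_N -> A), hyper_class_rel u -> rel A u) ->
  rel_functorial rel -> rel_multiplicative rel -> rel_transpose rel ->
  universal rel H -> closed_qsubgroup tens H.
Proof.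
move=> relO relC relF relM relT [uR ug ux]; split=> //; first exact: relO.
- have [D DE] : exists D : starhom (calg H) (tens (calg H) (calg H)), forall p,
      D (Defs.coord H p) = mul_entry (fun p => ctens_l _ (Defs.coord H p))
        (fun p => ctens_r _ (Defs.coord H p)) p.
    by apply/ux/relM => [p q||]; [exact: ctens_comm|exact: relF|exact: relF].
  by exists D => i j; rewrite DE.
- have [chi chiE] := ux _ _ (relC _ _ (hyperoctahedral_rel R N)).
  (* The counit is evaluation at the identity matrix, the signed permutation with trivial
     permutation and signs. *)
  have [|x xE] := @hyperoctahedral_point R N 1%:M.
    exists 1%g, [ffun=> false]; apply/matrixP => i j.
    by rewrite !mxE perm1 ffunE eq_sym; case: eqP.
  exists (fun a => chi a x); split=> [|c a b _ _|a b _ _|a _|i j].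
  + by rewrite rmorph1.
  + by rewrite linearP.
  + by rewrite rmorphM.
  + by rewrite starhom_star.
  + by rewrite chiE /= xE mxE rmorph_nat.
(* As [S] takes values in the opposite algebra, its multiplicativity reads as antimultiplicativity
   in [calg H]. *)
- have [S SE] := ux _ _ (relT _ _ uR).
  exists (fun a => S a); split=> [|c a b _ _|a b _ _|a _|i j].
  + exact: (rmorph1 S).
  + exact: (linearP S).
  + exact: (rmorphM S).
  + exact: (starhom_star S a).
  + by have /relO[us _ _] := uR; rewrite us SE.
Qed.

(** The prescribed value of a coaction on a coordinate, with both legs placed in one algebra. *)
Definition act_coord (N : nat) (A : nzRingType) (u : 'I_N * 'I_N -> A) (x : 'I_N -> A)
    (i : 'I_N) : A :=
  \sum_j u (i, j) * x j.

Section Action.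
Variables (R : realType) (N : nat) (A : cstarType R).
Variables (u : 'I_N * 'I_N -> A) (x : 'I_N -> A).
Hypothesis ux : forall p j, u p * x j = x j * u p.
Local Notation w := (act_coord u x).

Lemma act_star : hyper_free_rel u -> (forall j, star (x j) = x j) ->
  forall i, star (w i) = w i.
Proof.
move=> [[us _ _] _] xs i; rewrite star_sum.
by apply: eq_bigr => j _; rewrite starM us xs ux.
Qed.

Lemma act_sqr : hyper_free_rel u -> forall i,
  w i * w i = \sum_j (u (i, j) * u (i, j)) * (x j * x j).
Proof.
move=> uf i; rewrite /act_coord mixed_mul2 //; apply: eq_bigr => j _.
rewrite (bigD1 j) //= big1 ?addr0 // => k kj.
by rewrite free_mul_row 1?eq_sym // mul0r.
Qed.

Lemma act_involution : hyper_free_rel u -> (forall j, x j * x j = 1) ->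
  forall i, w i * w i = 1.
Proof.
move=> uf x1 i; rewrite act_sqr // -(free_row_sum uf i).
by apply: eq_bigr => j _; rewrite x1 mulr1.
Qed.

Lemma act_free_sphere : hyper_free_rel u -> free_sphere_rel x -> free_sphere_rel w.
Proof.
move=> uf [xs x1]; split; first exact: act_star.
under eq_bigr do rewrite expr2 act_sqr //.
rewrite exchange_big -x1 /=; apply: eq_bigr => j _; rewrite -mulr_suml.
by have /orthogonal_relP[_ _ ->] := uf.1; rewrite eqxx mul1r.
Qed.

Lemma act_half : hyper_half_rel u ->
  (forall i j k, x i * x j * x k = x k * x j * x i) ->
  forall i j k, w i * w j * w k = w k * w j * w i.
Proof.
move=> [_ uh] xh i j k; rewrite /act_coord !mixed_mul3 //.
under eq_bigr do rewrite exchange_big; rewrite exchange_big /=.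
apply: eq_bigr => c _; rewrite exchange_big; apply: eq_bigr => b _.
by apply: eq_bigr => a _; rewrite uh xh.
Qed.

Lemma act_comm : (forall p q, u p * u q = u q * u p) ->
  (forall i j, x i * x j = x j * x i) -> forall i j, w i * w j = w j * w i.
Proof.
move=> uC xC i j; rewrite /act_coord !mixed_mul2 // exchange_big /=.
by apply: eq_bigr => a _; apply: eq_bigr => b _; rewrite uC xC.
Qed.

Section Infty.
Hypothesis uR : hyper_infty_rel u.
Let uf : hyper_free_rel u := infty_free uR.

(** The square of [w i] is a sum of products of squares of entries of [u] and of coordinates; the
    former are central among the entries, the latter commute with the coordinates. *)
Lemma act_infty_sphere : infty_sphere_rel x -> infty_sphere_rel w.
Proof.
move=> [xs xi]; split=> [|i j]; first exact: act_free_sphere.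
rewrite expr2 act_sqr // mulr_suml mulr_sumr; apply: eq_bigr => k _.
apply: commr_sum => l _; apply: commrM; apply/commr_sym/commrM; apply/commr_sym.
- exact: infty_sqr_central.
- by apply/commr_sym/commrM; apply/commr_sym; rewrite /GRing.comm ux.
- by apply/commr_sym/commrM; rewrite /GRing.comm ux.
- by rewrite /GRing.comm -expr2 xi.
Qed.

(** The projection [u (i, j) * u (i, j)] selects one term of the sum [w i]. *)
Lemma sqr_mul_act i j : u (i, j) * u (i, j) * w i = u (i, j) * x j.
Proof.
rewrite mulr_sumr (bigD1 j) //= big1 ?addr0 => [|k kj].
  by rewrite mulrA free_sqr_mul // eqxx.
by rewrite mulrA free_sqr_mul // eq_sym (negPf kj) mul0r.
Qed.

Lemma sqr_act_comm p i : u p * u p * w i = w i * (u p * u p).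
Proof.
rewrite mulr_sumr mulr_suml; apply: eq_bigr => j _.
rewrite mulrA infty_sqr_central // -!mulrA; congr (_ * _).
by rewrite ux mulrA ux mulrA.
Qed.

(** Coefficient extraction: since squares of entries commute with every [w i], each projection can
    be moved next to the factor whose term it selects. *)
Lemma act_coef2 i j k l :
  (u (i, j) * u (i, j)) * (u (k, l) * u (k, l)) * (w i * w k) =
  u (i, j) * u (k, l) * (x j * x l).
Proof.
have := sqr_act_comm (k, l) i; have := sqr_mul_act i j; have := sqr_mul_act k l.
move: (u (i, j) * u (i, j)) (u (k, l) * u (k, l)) (w i) (w k) => P Q wi wk QE PE QC.
rewrite -(mulrA P) (mulrA Q) QC -(mulrA wi) QE (mulrA P) PE -!mulrA.
by congr (_ * _); rewrite !mulrA ux.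
Qed.

Lemma act_coef3 i j k l m n :
  (u (i, j) * u (i, j)) * (u (k, l) * u (k, l)) * (u (m, n) * u (m, n)) *
    (w i * w k * w m) =
  u (i, j) * u (k, l) * u (m, n) * (x j * x l * x n).
Proof.
have := act_coef2 i j k l; have := sqr_mul_act m n.
have := sqr_act_comm (m, n) k; have := sqr_act_comm (m, n) i.
move: (u (i, j) * u (i, j) * _) (u (m, n) * u (m, n)) (w i) (w k) (w m).
move=> PQ S wi wk wm Si Sk SE PQE; rewrite -(mulrA PQ).
(* The last projection moves past the first two factors to reach the one it acts on. *)
have -> : S * (wi * wk * wm) = wi * wk * (S * wm).
  by rewrite !mulrA Si -(mulrA wi S) Sk mulrA.
rewrite SE (mulrA PQ) PQE -!mulrA; congr (_ * (_ * _)).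
by rewrite (mulrA (x l)) -ux -mulrA (mulrA (x j)) -ux -mulrA.
Qed.

End Infty.

End Action.

(** A nonzero [b] is a linearly independent family of length one, so [ctens_inj] applies to the
    difference [a - a']. *)
Lemma cpure_injl (R : realType) (A B : cstarType R) (T : ctensor A B) (a a' : A)
    (b : B) :
  b != 0 -> cpure T a b = cpure T a' b -> a = a'.
Proof.
move=> b0 aa'; apply/eqP; rewrite -subr_eq0; apply/eqP.
apply: (@ctens_inj _ _ _ T 1 (fun=> a - a') (fun=> b) _ _ 0) => [c|].
  rewrite big_ord1 => /eqP cb i; rewrite (ord1 i); apply/eqP.
  apply: contraTT cb => c0; apply: contra b0 => /eqP cb.
  by rewrite -(scale1r b) -(mulVf c0) -scalerA cb scaler0.
rewrite big_ord1 rmorphB mulrBl; apply/eqP; rewrite subr_eq0; apply/eqP.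
exact: aa'.
Qed.

Section Maximality.
Variables (R : realType) (tens : tensor_product R) (N : nat).
Variables (G : qspace R ('I_N * 'I_N)) (X : qspace R 'I_N).
Local Notation u := (Defs.coord G).
Local Notation x := (Defs.coord X).
Hypothesis uR : hyper_infty_rel u.
Hypothesis GX : affine_action tens G X.

Let T := tens (calg G) (calg X).
Let lu p := ctens_l T (u p).
Let rx j := ctens_r T (x j).

Let luR : hyper_infty_rel lu := infty_functorial (ctens_l T) uR.
Let lurx p j : lu p * rx j = rx j * lu p.
Proof. exact: ctens_comm. Qed.

Lemma action_comm : (forall i j, x i * x j = x j * x i) ->
  (forall i j, x i * x j != 0) -> forall p q, u p * u q = u q * u p.
Proof.
move=> xC x0 [i j] [k l]; have [Phi PhiE] := GX.
have {}PhiE i' : Phi (x i') = act_coord lu rx i' by rewrite PhiE.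
have rC : rx j * rx l = rx l * rx j by rewrite -!rmorphM xC.
have WC : Phi (x i) * Phi (x k) = Phi (x k) * Phi (x i) by rewrite -!rmorphM xC.
have E1 := act_coef2 lurx luR i j k l; have E2 := act_coef2 lurx luR k l i j.
apply: (cpure_injl (T := T) (x0 j l)); rewrite /cpure !rmorphM.
rewrite -[LHS]/(lu (i, j) * lu (k, l) * (rx j * rx l)) -E1 -!PhiE WC.
(* The two squares are exchanged by centrality, to match the order of extraction in [E2]. *)
rewrite (mulrA _ (lu (k, l))) infty_sqr_central // -(mulrA (lu (k, l))).
rewrite infty_sqr_central // mulrA PhiE PhiE E2.
by rewrite -rC.
Qed.

Lemma action_half : (forall i j k, x i * x j * x k = x k * x j * x i) ->
  (forall i j k, x i * x j * x k != 0) -> hyper_half_rel u.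
Proof.
move=> xh x0; split=> [|[i j] [k l] [m n]]; first exact: infty_free.
have [Phi PhiE] := GX.
have {}PhiE i' : Phi (x i') = act_coord lu rx i' by rewrite PhiE.
have rC : rx j * rx l * rx n = rx n * rx l * rx j by rewrite -!rmorphM xh.
have WC : Phi (x i) * Phi (x k) * Phi (x m) = Phi (x m) * Phi (x k) * Phi (x i).
  by rewrite -!rmorphM xh.
have E1 := act_coef3 lurx luR i j k l m n.
have E2 := act_coef3 lurx luR m n k l i j.
(* Commuting squares allow the triple product of projections to be reversed, as [E2] requires. *)
have PC p q : lu p * lu p * (lu q * lu q) = lu q * lu q * (lu p * lu p).
  by rewrite mulrA infty_sqr_central // -mulrA infty_sqr_central // mulrA.
apply: (cpure_injl (T := T) (x0 j l n)); rewrite /cpure !rmorphM.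
rewrite -[LHS]/(lu (i, j) * lu (k, l) * lu (m, n) * (rx j * rx l * rx n)) -E1.
rewrite -!PhiE WC [X in X * _](_ : _ = lu (m, n) * lu (m, n) *
  (lu (k, l) * lu (k, l)) * (lu (i, j) * lu (i, j))).
  by rewrite !PhiE E2 -rC.
by rewrite (PC (i, j)) -mulrA (PC (i, j)) mulrA (PC (k, l)).
Qed.

End Maximality.

(** * The real sphere *)

Lemma starhom_pullback (R : realType) (X Y : topologicalType) (K : compact_set X)
    (L : compact_set Y) (g : set_type K -> set_type L) : continuous g ->
  exists F : starhom (cfun R L) (cfun R K), forall h x, F h x = h (g x).
Proof.
move=> gc; have hc (h : cfun R L) : continuous (fun x => h (g x) : R[i]^o).
  move=> x; apply: (@continuous_comp (set_type K) (set_type L) R[i]^o g h x).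
    exact: gc.
  exact: (@cfun_cont _ _ _ h (g x)).
have [c a b||a b|a|F FE] := @starhomP R (cfun R L) (cfun R K) (fun h => CFun (hc h)).
- exact: cfunP.
- exact: cfunP.
- exact: cfunP.
- exact: cfunP.
- by exists F => h x; rewrite FE.
Qed.

Section SphereAction.
Variables (R : realType) (N : nat) (N_gt0 : (0 < N)%N).
Local Notation S := (CompactSet (@sphere_compact R N) (sphere_neq0 R N_gt0)).
Local Notation X := (real_sphere R N_gt0).
Local Notation x := (Defs.coord X).

Lemma signed_perm_act (s : {perm 'I_N}) (e : {ffun 'I_N -> bool}) :
  exists F : starhom (calg X) (calg X), forall i, F (x i) = (-1) ^+ e i *: x (s i).
Proof.
pose m (z : 'rV[R]_N) : 'rV[R]_N := \row_i ((-1) ^+ e i * z 0 (s i)).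
have mS z : sphere R N z -> sphere R N (m z).
  rewrite /sphere /= => <-; rewrite [RHS](reindex_inj (@perm_inj _ s)).
  by apply: eq_bigr => i _; rewrite mxE exprMn sqrr_sign mul1r.
(* Each entry of [m z] is, up to sign, an entry of [z], so [m] does not increase entrywise
   distances. *)
have mc : continuous m.
  move=> z U /nbhs_ballP[r /= r0 rU]; apply/nbhs_ballP; exists r => //= y zy.
  apply: rU; split=> // i j; rewrite !mxE; have := zy.2 0 (s j).
  rewrite /ball /= -mulrBr normrM normrX normrN1 expr1n.
  by rewrite mul1r.
pose g (z : set_type S) : set_type S :=
  exist _ (m (val z)) (mem_set (mS _ (set_mem (valP z)))).
have gc : continuous g.
  apply: continuous_comp_initial => z.
  apply: (@continuous_comp (set_type S) 'rV[R]_N 'rV[R]_N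
    (fun z : set_type S => val z) m z).
    by have := @initial_continuous (set_type S) _ set_val; rewrite set_valE; apply.
  exact: mc.
have [F FE] := starhom_pullback R gc.
exists F => i; apply: cfunP => z; rewrite FE cfun_scaleE /= mxE.
by rewrite rmorphM rmorph_sign.
Qed.

Lemma hyperoctahedral_act (M : 'M[R]_N) : hyperoctahedral R N M ->
  exists F : starhom (calg X) (calg X),
    forall i, F (x i) = \sum_j (M i j)%:C *: x j.
Proof.
move=> [s [e ->]]; have [F FE] := signed_perm_act s e; exists F => i.
rewrite FE (bigD1 (s i)) //= mxE eqxx rmorph_sign big1 ?addr0 // => j /negPf ji.
by rewrite mxE ji scale0r.
Qed.

Lemma real_sphere_rel : half_sphere_rel x.
Proof.
split=> [|i j k]; last by apply: cfunP => z /=; rewrite mulrC mulrA mulrAC.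
split=> [i|]; apply: cfunP => z; first exact: conjc_real.
rewrite cfun_sumE -[RHS]/(1%:C) -(set_mem (valP z)) rmorph_sum.
by apply: eq_bigr => i _; rewrite rmorphXn.
Qed.

(** [real_sphere] is a concrete function algebra, so the coaction is built by hand: the rotations of
    the sphere by the points of the finite group are glued along the joint projections of the left
    leg. *)
Lemma real_sphere_action (tens : tensor_product R) :
  affine_action tens (hyperoctahedral_group R N) X.
Proof.
pose H := hyperoctahedral_group R N; pose T := tens (calg H) (calg X).
pose lu p := ctens_l T (Defs.coord H p).
have luR : hyper_class_rel lu.
  exact/(class_functorial (ctens_l T))/hyperoctahedral_rel.
have [pt ptE] := choice (@row_point R N).
have [phi phiE] := choice (fun f => hyperoctahedral_act (set_mem (valP (pt f)))).
have [psi psiE] := choice (fun f => starhom_comp (phi f) (ctens_r T)).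
have [f a|F FE] := starhom_glue (phi := psi) (row_proj_comm luR) (row_proj_star luR)
  (row_proj_idem luR) (row_proj_sum luR).
  rewrite psiE; apply/commr_sym; apply: joint_proj_comm => i t.
  rewrite /row_proj -scalerAl -scalerAr mulrDl mulrDr -scalerAl -scalerAr.
  by rewrite !mulrA -!(ctens_comm T) -mulrA -(ctens_comm T) mulrA.
exists F => i; rewrite FE.
under eq_bigr do rewrite psiE phiE raddf_sum mulr_sumr.
rewrite exchange_big /=; apply: eq_bigr => j _; rewrite /cpure.
(* A partition of unity is inserted on the right, where each joint projection turns the entry (i, j)
   into the number by which the rotation acts. *)
rewrite -[in RHS](mul1r (ctens_l T _)) -(joint_proj_sum (row_proj_sum luR)).
rewrite !mulr_suml; apply: eq_bigr => f _.
have := row_point_eigen luR ptE f (i, j) => /= ->.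
by rewrite linearZ /= -scalerAr -scalerAl.
Qed.

End SphereAction.

(** * Noncommutative cubes *)

Definition involutions (R : realType) (I : Type) (B : cstarType R) (y : I -> B) :
    Prop :=
  (forall i, star (y i) = y i) /\ forall i, y i * y i = 1.

Lemma involutions_functorial (R : realType) (I : Type) (A B : cstarType R)
    (f : starhom A B) (y : I -> A) :
  involutions y -> involutions (fun i => f (y i)).
Proof.
by move=> [ys y1]; split=> i; rewrite -?starhom_star -?rmorphM ?ys ?y1 ?rmorph1.
Qed.

Lemma involutions_unitary (R : realType) (I : Type) (G : groupType)
    (B : cstarType R) (pi : G -> B) (g : I -> G) :
  unitary_rep pi -> (forall i, g i * g i = 1)%g -> involutions (fun i => pi (g i)).
Proof.
move=> [p1 pM pV] g1; have y1 i : pi (g i) * pi (g i) = 1 by rewrite -pM g1 p1.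
split=> // i; rewrite -[LHS]mulr1 -(y1 i) mulrA pV -pM mulVg p1 mul1r //.
Qed.

Section WordRepresentation.
Variables (R : realType) (I : choiceType) (r : seq I -> seq I -> Prop).
Variables (B : cstarType R) (y : I -> B).
Hypothesis yI : involutions y.
Hypothesis yr : forall a b, r a b -> \prod_(i <- a) y i = \prod_(i <- b) y i.

Lemma word_eqv_prod a b : word_eqv r a b -> \prod_(i <- a) y i = \prod_(i <- b) y i.
Proof.
elim=> {a b} [//|a b _ ->//|a b c _ -> _ ->//|a a' b b' _ aa' _ bb'|i|]; last exact: yr.
  by rewrite !big_cat aa' bb'.
by rewrite big_cons big_seq1 big_nil yI.2.
Qed.

Lemma star_prod_rev (a : seq I) : star (\prod_(i <- a) y i) = \prod_(i <- rev a) y i.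
Proof.
elim: a => [|i a IH]; first by rewrite !big_nil star1.
by rewrite rev_cons -cats1 big_cat big_seq1 big_cons starM IH yI.1.
Qed.

(** Words have no inverse letters: an element acts by the product along a representative word, and
    its inverse by the reversed word, which is the adjoint. *)
Lemma invol_group_rep : exists2 pi : invol_group r -> B,
  unitary_rep pi & forall i, pi (invol_gen r i) = y i.
Proof.
pose pi (g : invol_group r) := \prod_(i <- generic_quotient.repr g) y i.
have piE a : pi (word_class r a) = \prod_(i <- a) y i.
  by apply: word_eqv_prod; apply/word_classP; exact: word_repr.
exists pi => [|i]; last by rewrite piE big_seq1.
split=> [|g h|g].
- by rewrite -[1%g]/(word_class r [::]) piE big_nil.
- by rewrite -[(g * h)%g]/(word_class r _) piE big_cat.
- by rewrite -[(g^-1)%g]/(word_class r _) piE star_prod_rev.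
Qed.

Lemma invol_gen_sqr i : (invol_gen r i * invol_gen r i = 1)%g.
Proof.
rewrite -[LHS]/(invol_mul (word_class r [:: i]) (word_class r [:: i])) invol_mulE.
by apply/word_classP; exact: weqv_invol.
Qed.

End WordRepresentation.

Lemma Z2_free_rep (R : realType) (N : nat) (B : cstarType R) (y : 'I_N -> B) :
  involutions y -> exists2 pi : Z2_free N -> B,
    unitary_rep pi & forall i, pi (Z2_free_gen i) = y i.
Proof. by move=> yI; exact: invol_group_rep. Qed.

Lemma Z2_half_rep (R : realType) (N : nat) (B : cstarType R) (y : 'I_N -> B) :
  involutions y -> (forall i j k, y i * y j * y k = y k * y j * y i) ->
  exists2 pi : Z2_half N -> B,
    unitary_rep pi & forall i, pi (Z2_half_gen i) = y i.
Proof.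
move=> yI yh; apply: invol_group_rep => // _ _ [i [j [k [-> ->]]]].
by rewrite !big_cons !big_nil !mulr1 !mulrA.
Qed.

Lemma Z2_half_gen_comm (N : nat) (i j k : 'I_N) :
  (Z2_half_gen i * Z2_half_gen j * Z2_half_gen k =
   Z2_half_gen k * Z2_half_gen j * Z2_half_gen i)%g.
Proof.
pose w := word_class (@half_comm N).
rewrite -[LHS]/(invol_mul (invol_mul (w [:: i]) (w [:: j])) (w [:: k])).
rewrite -[RHS]/(invol_mul (invol_mul (w [:: k]) (w [:: j])) (w [:: i])).
have wM a b : invol_mul (w a) (w b) = w (a ++ b) by exact: invol_mulE.
rewrite (wM [:: i]) (wM [:: k]) !wM; apply/word_classP; apply: weqv_rel.
by exists i, j, k; split.
Qed.

Lemma Z2_pow_mulE (N : nat) (g h : Z2_pow N) i : (g * h)%g i = (g i * h i)%g.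
Proof. exact: mulg_ffun. Qed.

Lemma Z2_pow_gen_sqr (N : nat) (i : 'I_N) : (Z2_pow_gen i * Z2_pow_gen i = 1)%g.
Proof.
apply/ffunP => j; rewrite Z2_pow_mulE !ffunE.
by case: (j == i); apply: val_inj.
Qed.

Lemma Z2_pow_comm (N : nat) (g h : Z2_pow N) : (g * h = h * g)%g.
Proof. by apply/ffunP => j; rewrite !Z2_pow_mulE [LHS]Zp_mulgC. Qed.

Lemma Z2_pow_rep (R : realType) (N : nat) (B : cstarType R) (y : 'I_N -> B) :
  involutions y -> (forall i j, y i * y j = y j * y i) ->
  exists2 pi : Z2_pow N -> B,
    unitary_rep pi & forall i, pi (Z2_pow_gen i) = y i.
Proof.
move=> [ys y1] yC; have yC' i j m n : GRing.comm (y i ^+ m) (y j ^+ n).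
  by apply: commrX; apply/commr_sym/commrX/yC.
(* Elements of ['Z_2] serve as exponents 0 or 1; since each [y i] squares to 1, addition modulo 2 is
   respected. *)
exists (fun g : Z2_pow N => \prod_i y i ^+ (g i : 'Z_2)) => [|i]; last first.
  rewrite -[RHS](big_pred1_eq *%R i y) [RHS]big_mkcond; apply: eq_bigr => j _.
  by rewrite ffunE; case: eqP => // ->.
split=> [|g h|g].
- by rewrite big1 // => i _; rewrite ffunE.
- rewrite -prodrM_comm => [|i j _ _]; last exact: yC'.
  apply: eq_bigr => i _; rewrite Z2_pow_mulE.
  case: (g i) (h i) => [[|[|//]] ?] [[|[|//]] ?] /=; rewrite ?mul1r ?mulr1 //.
  by rewrite y1.
- rewrite star_prod_comm => [|i j]; last exact: yC'.
  apply: eq_bigr => i _.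
  have -> : (g^-1)%g i = (g i)^-1%g by exact: invg_ffun.
  by case: (g i) => [[|[|//]] ?] /=; rewrite ?star1 ?ys.
Qed.

Section Cube.
Variables (R : realType) (N : nat).
Local Notation c := ((Num.sqrt (N%:R : R))^-1%:C : R[i]).

(** Each rescaled square is the scalar 1/N, so it is central and the N squares sum to 1. *)
Lemma involutions_sphere (B : cstarType R) (y : 'I_N -> B) :
  (0 < N)%N -> involutions y -> infty_sphere_rel (fun i => c *: y i).
Proof.
move=> N0 [ys y1].
have sq i : (c *: y i) ^+ 2 = (N%:R^-1 : R)%:C *: 1.
  rewrite exprZn [y i ^+ 2]expr2 y1 -rmorphXn exprVn sqr_sqrtr //; exact: ler0n.
split=> [|i j]; last by rewrite sq -scalerAl mul1r -[RHS]scalerAr mulr1.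
split=> [i|]; first by rewrite starZ ys; congr (_ *: _); exact: conjc_real.
rewrite (eq_bigr _ (fun i _ => sq i)) sumr_const card_ord -scaler_nat scalerA.
rewrite -(rmorph_nat (real_complex R)) -rmorphM divff ?scale1r //.
by rewrite pnatr_eq0 -lt0n.
Qed.

Lemma involution_mul_neq0 (B : cstarType R) (y : 'I_N -> B) i b :
  involutions y -> b != 0 -> y i * b != 0.
Proof.
move=> [_ y1]; apply: contra => /eqP yb.
by rewrite -(mul1r b) -(y1 i) -mulrA yb mulr0.
Qed.

Lemma cube_scale_neq0 : (0 < N)%N -> c != 0.
Proof.
move=> N0; rewrite fmorph_eq0 invr_eq0 gt_eqF // sqrtr_gt0 ltr0n //.
Qed.

(** The scalar 1/sqrt N passes through the coaction formula, which leaves a unitary representation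
    with prescribed values on the generators. *)
Lemma dual_cube_action (tens : tensor_product R) (G : qspace R ('I_N * 'I_N))
    (Ga : groupType) (g : 'I_N -> Ga) (U : qspace R Ga)
    (T := tens (calg G) (calg U)) : group_cstar U ->
  (exists2 pi : Ga -> T, unitary_rep pi & forall i, pi (g i) =
    act_coord (fun p => ctens_l T (Defs.coord G p))
      (fun j => ctens_r T (Defs.coord U (g j))) i) ->
  affine_action tens G (dual_cube g U).
Proof.
move=> [_ _ Uu] [pi piU piE]; have [Phi PhiE] := Uu _ _ piU; exists Phi => i.
rewrite /dual_cube /= linearZ /= PhiE piE scaler_sumr; apply: eq_bigr => j _.
by rewrite /cpure linearZ /= scalerAr.
Qed.

Lemma dual_cube_qincl (Ga De : groupType) (g : 'I_N -> Ga) (d : 'I_N -> De)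
    (U : qspace R Ga) (V : qspace R De) : group_cstar V ->
  (exists2 pi : De -> calg U,
    unitary_rep pi & forall i, pi (d i) = Defs.coord U (g i)) ->
  qincl (dual_cube g U) (dual_cube d V).
Proof.
move=> [_ _ Vu] [pi piU piE]; have [f fE] := Vu _ _ piU; exists f => i.
by rewrite /= linearZ /= fE piE.
Qed.

End Cube.

(** The vertices of the inscribed cube serve twice: as joint spectrum of the commuting generators,
    and as points where no coordinate vanishes. *)
Lemma cube_point (R : realType) (N : nat) (f : 'I_N -> bool) : (0 < N)%N ->
  exists z : set_type (sphere R N),
    forall i, val z 0 i = (-1) ^+ f i * (Num.sqrt N%:R)^-1.
Proof.
move=> N0; pose z : 'rV[R]_N := \row_i ((-1) ^+ f i * (Num.sqrt N%:R)^-1).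
have zS : sphere R N z.
  rewrite /sphere /= (eq_bigr (fun=> N%:R^-1)) => [|i _]; last first.
    by rewrite mxE exprMn sqrr_sign mul1r exprVn sqr_sqrtr // ler0n.
  by rewrite sumr_const card_ord -[LHS]mulr_natr mulVf // pnatr_eq0 -lt0n.
by exists (exist _ z (mem_set zS)) => i /=; rewrite mxE.
Qed.

(* A function on the sphere restricts to the points of coordinates [+-1 / sqrt N],
   the joint spectrum of the commuting generators of the cube. *)
Lemma cube_in_real_sphere (R : realType) (N : nat) (N_gt0 : (0 < N)%N)
    (B : cstarType R) (y : 'I_N -> B) :
  involutions y -> (forall i j, y i * y j = y j * y i) ->
  exists F : starhom (calg (real_sphere R N_gt0)) B,
    forall i, F (Defs.coord (real_sphere R N_gt0) i) =
      (Num.sqrt (N%:R : R))^-1%:C *: y i.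
Proof.
move=> [ys y1] yC; set c := (Num.sqrt (N%:R : R))^-1.
(* The spectral projection of the involution [y i] for the eigenvalue (-1)^b. *)
pose q i (b : bool) : B := 2^-1 *: (1 + (-1) ^+ b *: y i).
have qy i b : q i b * y i = (-1) ^+ b *: q i b.
  rewrite /q -scalerAl mulrDl mul1r -scalerAl y1 [RHS]scalerA [_ * 2^-1]mulrC.
  rewrite -[RHS]scalerA; congr (_ *: _).
  by rewrite scalerDr scalerA -signr_addb addbb scale1r addrC.
have qC' i b z : y i * z = z * y i -> q i b * z = z * q i b.
  move=> yz; rewrite /q -scalerAl -scalerAr mulrDl mulrDr -scalerAl -scalerAr yz.
  by rewrite mul1r mulr1.
have qC i s j t : q i s * q j t = q j t * q i s.
  by apply: (qC'); apply/esym/(qC')/yC.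
have qs i s : star (q i s) = q i s.
  rewrite /q starZ starD starZ ys star1; congr (_ *: (_ + _ *: _)).
    by rewrite fmorphV rmorph_nat.
  by rewrite rmorph_sign.
have qq i s t : q i s * q i t = if s == t then q i s else 0.
  have := qy i s; move: (q i s) => z zE.
  rewrite /q -scalerAr mulrDr mulr1 -scalerAr zE scalerA -signr_addb.
  case: s t {zE} => [] [] /=; rewrite ?scaleN1r ?scale1r ?subrr ?scaler0 //.
    exact: half_scale.
  exact: half_scale.
have q1 i : \sum_s q i s = 1.
  rewrite big_bool /q /= -scalerDr expr0 expr1.
  by rewrite scale1r scaleN1r addrACA addNr addr0 half_scale.
have [x xE] := choice (fun f : {ffun 'I_N -> bool} => cube_point R f N_gt0).
have [F FE] := @starhom_joint_eval _ _ _ _ _ qC qs qq q1 _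
  (CompactSet (@sphere_compact R N) (sphere_neq0 R N_gt0)) x.
exists F => i; apply: (starhom_joint_eval_eigen q1 FE) => f.
apply: (joint_proj_eigen qC qq (i := i)); rewrite -scalerAr qy scalerA /= xE.
by rewrite rmorphM rmorph_sign mulrC.
Qed.

(** * The three reflection groups as largest acting quantum groups *)

Section ReflectionGroups.
Variables (R : realType) (tens : tensor_product R) (N : nat).
Variables (H_half H_infty : qspace R ('I_N * 'I_N)).
Hypothesis HH_half : universal (@hyper_half_rel R N) H_half.
Hypothesis HH_infty : universal (@hyper_infty_rel R N) H_infty.
Local Notation H_class := (hyperoctahedral_group R N).
Variable X : qspace R 'I_N.
Local Notation x := (Defs.coord X).

Lemma qincl_universal (I : Type) (rel : forall A : cstarType R, (I -> A) -> Prop)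
    (Y Z : qspace R I) : universal rel Z -> rel _ (Defs.coord Y) -> qincl Y Z.
Proof. by move=> [_ _ Zu] /Zu. Qed.

Lemma qincl_infty (G : qspace R ('I_N * 'I_N)) :
  qincl G H_infty -> hyper_infty_rel (Defs.coord G).
Proof.
move=> [f fE]; have [uR _ _] := HH_infty.
by have := infty_functorial f uR; congr hyper_infty_rel; apply/funext.
Qed.

(** The action is a hypothesis because it arises by gluing for the sphere and from a universal
    property for the cube. *)
Lemma reflection_group_class : affine_action tens H_class X ->
  (forall i j, x i * x j = x j * x i) -> (forall i j, x i * x j != 0) ->
  qreflection_group tens H_infty X H_class.
Proof.
move=> HX xC x0; split=> [|G [_ /qincl_infty GI GX]].
  split=> //; last exact/(qincl_universal HH_infty)/class_infty/hyperoctahedral_rel.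
  apply: closed_qsubgroup_universal (@hyperoctahedral_universal R N) => //.
  - by move=> A u [[]].
  - exact: class_functorial.
  - exact: class_multiplicative.
  - exact: class_transpose.
apply: qincl_universal (@hyperoctahedral_universal R N) _; split.
  exact: infty_free.
exact: action_comm GX xC x0.
Qed.

Lemma reflection_group_half : affine_action tens H_half X ->
  (forall i j k, x i * x j * x k = x k * x j * x i) ->
  (forall i j k, x i * x j * x k != 0) ->
  qreflection_group tens H_infty X H_half.
Proof.
move=> HX xh x0; split=> [|G [_ /qincl_infty GI GX]]; last first.
  exact/(qincl_universal HH_half)/(action_half GI GX).
have [uR _ _] := HH_half.
split=> //; last exact/(qincl_universal HH_infty)/half_infty.
apply: closed_qsubgroup_universal HH_half.
- by move=> A u [[]].
- by move=> A u; exact: class_half.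
- exact: half_functorial.
- exact: half_multiplicative.
- exact: half_transpose.
Qed.

(** Maximality is immediate: the competing groups lie in [H_infty] by definition, so only the action
    has content. *)
Lemma reflection_group_infty : affine_action tens H_infty X ->
  qreflection_group tens H_infty X H_infty.
Proof.
move=> HX; split=> [|G []//]; have [uR _ _] := HH_infty.
split=> //; last exact: (qincl_universal HH_infty).
apply: closed_qsubgroup_universal HH_infty.
- by move=> A u [].
- by move=> A u; exact: class_infty.
- exact: infty_functorial.
- exact: infty_multiplicative.
- exact: infty_transpose.
Qed.

Lemma universal_action (rel : forall A : cstarType R, ('I_N -> A) -> Prop)
    (G : qspace R ('I_N * 'I_N)) (T := tens (calg G) (calg X)) : universal rel X ->
  rel T (act_coord (fun p => ctens_l T (Defs.coord G p)) (fun j => ctens_r T (x j))) ->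
  affine_action tens G X.
Proof. by move=> [_ _ Xu] /Xu[Phi PhiE]; exists Phi. Qed.

End ReflectionGroups.

Lemma free_sphere_functorial (R : realType) (N : nat) (A B : cstarType R)
    (f : starhom A B) (x : 'I_N -> A) :
  free_sphere_rel x -> free_sphere_rel (fun i => f (x i)).
Proof.
move=> [xs x1]; split=> [i|]; first by rewrite -starhom_star xs.
by under eq_bigr do rewrite -rmorphXn; rewrite -rmorph_sum x1 rmorph1.
Qed.

Lemma half_sphere_functorial (R : realType) (N : nat) (A B : cstarType R)
    (f : starhom A B) (x : 'I_N -> A) :
  half_sphere_rel x -> half_sphere_rel (fun i => f (x i)).
Proof.
move=> [xf xh]; split=> [|i j k]; first exact: free_sphere_functorial.
by rewrite -!rmorphM xh.
Qed.

Lemma infty_sphere_functorial (R : realType) (N : nat) (A B : cstarType R)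
    (f : starhom A B) (x : 'I_N -> A) :
  infty_sphere_rel x -> infty_sphere_rel (fun i => f (x i)).
Proof.
move=> [xf xh]; split=> [|i j]; first exact: free_sphere_functorial.
by rewrite -rmorphXn -!rmorphM xh.
Qed.

Section Cubes.
Variables (R : realType) (N : nat).

Lemma Z2_pow_involutions (U : qspace R (Z2_pow N)) : group_cstar U ->
  involutions (fun i => Defs.coord U (Z2_pow_gen i)).
Proof.
by move=> [Ur _ _]; apply: involutions_unitary Ur _ => i; exact: Z2_pow_gen_sqr.
Qed.

Lemma Z2_half_involutions (U : qspace R (Z2_half N)) : group_cstar U ->
  involutions (fun i => Defs.coord U (Z2_half_gen i)).
Proof.
by move=> [Ur _ _]; apply: involutions_unitary Ur _ => i; exact: invol_gen_sqr.
Qed.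

Lemma Z2_free_involutions (U : qspace R (Z2_free N)) : group_cstar U ->
  involutions (fun i => Defs.coord U (Z2_free_gen i)).
Proof.
by move=> [Ur _ _]; apply: involutions_unitary Ur _ => i; exact: invol_gen_sqr.
Qed.

Lemma Z2_pow_cstar_comm (U : qspace R (Z2_pow N)) : group_cstar U ->
  forall g h, Defs.coord U g * Defs.coord U h = Defs.coord U h * Defs.coord U g.
Proof. by move=> [[_ UM _] _ _] g h; rewrite -!UM Z2_pow_comm. Qed.

Lemma Z2_half_cstar_comm (U : qspace R (Z2_half N)) : group_cstar U ->
  forall i j k (y := fun i => Defs.coord U (Z2_half_gen i)),
    y i * y j * y k = y k * y j * y i.
Proof. by move=> [[_ UM _] _ _] i j k /=; rewrite -!UM Z2_half_gen_comm. Qed.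

End Cubes.

Lemma scaled_mul2 (R : realType) (A : cstarType R) (c : R[i]) (a b : A) :
  (c *: a) * (c *: b) = c ^+ 2 *: (a * b).
Proof. by rewrite -scalerAl -scalerAr scalerA. Qed.

Lemma scaled_mul3 (R : realType) (A : cstarType R) (c : R[i]) (a b d : A) :
  (c *: a) * (c *: b) * (c *: d) = c ^+ 3 *: (a * b * d).
Proof. by rewrite scaled_mul2 -scalerAl -scalerAr scalerA -exprSr. Qed.

Lemma tensor_act_involutions (R : realType) (N : nat) (A B : cstarType R)
    (T : ctensor A B) (u : 'I_N * 'I_N -> A) (y : 'I_N -> B) :
  hyper_free_rel u -> involutions y ->
  involutions (act_coord (fun p => ctens_l T (u p)) (fun j => ctens_r T (y j))).
Proof.
move=> /(free_functorial (ctens_l T)) lu /(involutions_functorial (ctens_r T)) ry.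
have C p j : ctens_l T (u p) * ctens_r T (y j) = ctens_r T (y j) * ctens_l T (u p).
  exact: ctens_comm.
by split; [exact: act_star ry.1|exact: act_involution ry.2].
Qed.

Lemma involutions_mul3_neq0 (R : realType) (N : nat) (B : cstarType R)
    (y : 'I_N -> B) : involutions y -> forall i j k, y i * y j * y k != 0.
Proof.
move=> yI i j k; rewrite -mulrA -[y k]mulr1.
by do 3!apply: (involution_mul_neq0 _ yI); exact: oner_neq0.
Qed.

Theorem proposition5p5 (R : realType) (tens : tensor_product R)
    (N : nat) (N_gt0 : (0 < N)%N)
    (H_half H_infty : qspace R ('I_N * 'I_N))
    (HH_half : universal (@hyper_half_rel R N) H_half)
    (HH_infty : universal (@hyper_infty_rel R N) H_infty)
    (S_half S_infty : qspace R 'I_N)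
    (HS_half : universal (@half_sphere_rel R N) S_half)
    (HS_infty : universal (@infty_sphere_rel R N) S_infty)
    (U_pow : qspace R (Z2_pow N)) (HU_pow : group_cstar U_pow)
    (U_half : qspace R (Z2_half N)) (HU_half : group_cstar U_half)
    (U_free : qspace R (Z2_free N)) (HU_free : group_cstar U_free) :
  let S_real := real_sphere R N_gt0 in
  let Q_pow := dual_cube (@Z2_pow_gen N) U_pow in
  let Q_half := dual_cube (@Z2_half_gen N) U_half in
  let Q_free := dual_cube (@Z2_free_gen N) U_free in
  let H_class := hyperoctahedral_group R N in
  [/\ [/\ qincl Q_pow Q_half, qincl Q_half Q_free,
          qincl S_real S_half & qincl S_half S_infty],
      [/\ qincl Q_pow S_real, qincl Q_half S_half & qincl Q_free S_infty],
      [/\ qreflection_group tens H_infty S_real H_class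
        & qreflection_group tens H_infty Q_pow H_class],
      [/\ qreflection_group tens H_infty S_half H_half
        & qreflection_group tens H_infty Q_half H_half]
    & [/\ qreflection_group tens H_infty S_infty H_infty,
          qreflection_group tens H_infty Q_free H_infty,
          qincl H_class H_half & qincl H_half H_infty]].
Proof.
move=> S_real Q_pow Q_half Q_free H_class.
have [half_u _ _] := HH_half; have [infty_u _ _] := HH_infty.
have [half_x _ _] := HS_half; have [infty_x _ _] := HS_infty.
have class_u := hyperoctahedral_rel R N.
have pow_y := Z2_pow_involutions HU_pow.
have half_y := Z2_half_involutions HU_half.
have free_y := Z2_free_involutions HU_free.
have pow_C := Z2_pow_cstar_comm HU_pow.
have half_C := Z2_half_cstar_comm HU_half.
(* The half-commutation relation with its first two factors equal makes the squares central. *)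
have half_infty_x (A : cstarType R) (x : 'I_N -> A) :
    half_sphere_rel x -> infty_sphere_rel x.
  by move=> [xf xh]; split=> // i j; rewrite expr2 xh mulrA.
have c0 : ((Num.sqrt (N%:R : R))^-1%:C : R[i]) != 0 by exact: cube_scale_neq0.
have Q_half_rel : half_sphere_rel (Defs.coord Q_half).
  split=> [|i j k]; first by have [] := involutions_sphere N_gt0 half_y.
  by rewrite /= !scaled_mul3 half_C.
have S_real_half : qincl S_real S_half.
  exact/(qincl_universal HS_half)/real_sphere_rel.
have S_real_neq0 i j k : Defs.coord S_real i * Defs.coord S_real j *
    Defs.coord S_real k != 0.
  (* At the vertex with all signs positive every coordinate is 1/sqrt N. *)
  have [z zE] := cube_point R (fun=> false) N_gt0.
  apply/eqP => /(congr1 (fun f : calg S_real => f z)); apply/eqP.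
  by rewrite /= !zE expr0 !mul1r !mulf_neq0.
have prod2_neq0 (A : cstarType R) (a b : A) : a * b * b != 0 -> a * b != 0.
  by apply: contra => /eqP ->; rewrite mul0r.
split; split.
- apply: dual_cube_qincl HU_half _; apply: Z2_half_rep => // i j k.
  rewrite (pow_C (Z2_pow_gen i)) -mulrA (pow_C (Z2_pow_gen i)) mulrA.
  by rewrite (pow_C (Z2_pow_gen j)).
- by apply: dual_cube_qincl HU_free _; exact: Z2_free_rep.
- exact: S_real_half.
- exact/(qincl_universal HS_infty)/half_infty_x.
(* This inclusion restricts concrete functions to the vertices of the cube, in place of a universal
   property. *)
- have [//|F FE] := cube_in_real_sphere N_gt0 pow_y; first by exists F.
- exact: qincl_universal HS_half _.
- exact/(qincl_universal HS_infty)/involutions_sphere.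
- apply: reflection_group_class => //; first exact: real_sphere_action.
  + by move=> i j; apply: cfunP => z /=; rewrite mulrC.
  + by move=> i j; exact: prod2_neq0.
- apply: reflection_group_class => //.
  + apply: dual_cube_action HU_pow _; apply: Z2_pow_rep.
      exact: tensor_act_involutions class_u.1 pow_y.
    apply: act_comm => [p j|p q|i j]; first exact: ctens_comm.
      by rewrite -!rmorphM class_u.2.
    by rewrite -!rmorphM pow_C.
  + by move=> i j; rewrite /= !scaled_mul2 pow_C.
  + move=> i j; rewrite /= scaled_mul2 scaler_eq0 negb_or expf_neq0 //=.
    exact: prod2_neq0 (involutions_mul3_neq0 pow_y i j j).
- apply: reflection_group_half => //.
  + apply: universal_action HS_half _.
    have lu := half_functorial (ctens_l (tens (calg H_half) (calg S_half))) half_u.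
    have rx := half_sphere_functorial
      (ctens_r (tens (calg H_half) (calg S_half))) half_x.
    have C p j := ctens_comm (tens (calg H_half) (calg S_half))
      (Defs.coord H_half p) (Defs.coord S_half j).
    by split; [exact: act_free_sphere lu.1 rx.1|exact: act_half lu rx.2].
  + exact: half_x.2.
  (* A monomial vanishing on [S_half] would also vanish on its closed subset [S_real]. *)
  + move=> i j k; have [f fE] := S_real_half; apply: contra (S_real_neq0 i j k).
    by move=> /eqP/(congr1 f); rewrite rmorph0 !rmorphM /= !fE => ->.
- apply: reflection_group_half => //.
  + apply: dual_cube_action HU_half _; apply: Z2_half_rep.
      exact: tensor_act_involutions half_u.1 half_y.
    apply: act_half => [p j||i j k]; first exact: ctens_comm.
      exact: half_functorial half_u.
    by rewrite -!rmorphM half_C.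
  + exact: Q_half_rel.2.
  + move=> i j k; rewrite /= scaled_mul3 scaler_eq0 negb_or expf_neq0 //=.
    exact: involutions_mul3_neq0 half_y _ _ _.
- apply: reflection_group_infty => //; apply: universal_action HS_infty _.
  apply: act_infty_sphere => [p j||]; first exact: ctens_comm.
    exact: infty_functorial infty_u.
  exact: infty_sphere_functorial infty_x.
- apply: reflection_group_infty => //; apply: dual_cube_action HU_free _.
  by apply: Z2_free_rep; apply: tensor_act_involutions free_y; exact: infty_free.
- exact/(qincl_universal HH_half)/class_half.
- exact/(qincl_universal HH_infty)/half_infty.
Qed.
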